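(* If $G$ is an infinite locally finite connected graph, then $G^2\square K_2$ has a Hamiltonian circle.
   Context: $G^2$ is the square of $G$: the graph on $V(G)$ with an edge between any two distinct vertices at distance at most 2 in $G$. $H\square K_2$ is the Cartesian product of $H$ with $K_2$. A ray is a one-way infinite path; two rays of a graph $H$ are equivalent if for every finite $S\subseteq V(H)$ some component of $H-S$ contains tails of both; the classes are the ends of $H$. For finite $S$ and an end $\alpha$, $C(S,\alpha)$ is the component of $H-S$ containing tails of rays of $\alpha$. The Freudenthal compactification $|H|$ of a locally finite graph $H$ is its 1-complex together with its ends, a basic open neighbourhood of an end $\alpha$ being, for finite $S$, the union of $C(S,\alpha)$, the ends whose rays have tails in $C(S,\alpha)$, and the inner points of edges between $S$ and $C(S,\alpha)$. A Hamiltonian circle of $H$ is the image of a homeomorphic embedding of $S^1$ into $|H|$ that contains every vertex of $H$. *)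

(* Defs.v *)
From Stdlib Require Import Reals List Relations Classical.
Open Scope R_scope.

Section Graphs.
Variable V : Type.

Definition graph := V -> V -> Prop.

Definition simple_graph (adj : graph) : Prop :=
  (forall u v, adj u v -> adj v u) /\ (forall v, ~ adj v v).

Definition locally_finite (adj : graph) : Prop :=
  forall v, exists l : list V, forall w, adj v w -> In w l.

Definition connected (adj : graph) : Prop :=
  forall u v, clos_refl_trans V adj u v.

Definition infinite_type : Prop := ~ exists l : list V, forall v, In v l.

Definition graph_square (adj : graph) : graph :=
  fun u v => u <> v /\ (adj u v \/ exists w, adj u w /\ adj w v).
End Graphs.

Definition box_K2 {V : Type} (adj : graph V) : graph (V * bool) :=
  fun x y => (snd x = snd y /\ adj (fst x) (fst y)) \/
             (fst x = fst y /\ snd x <> snd y).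

Section Freudenthal.
Variables (V : Type) (adj : graph V).

Definition ray (r : nat -> V) : Prop :=
  (forall m n, r m = r n -> m = n) /\ (forall n, adj (r n) (r (S n))).

Definition same_comp (S : list V) (x y : V) : Prop :=
  ~ In x S /\ ~ In y S /\
  clos_refl_trans V (fun a b => adj a b /\ ~ In a S /\ ~ In b S) x y.

Definition tail_in_comp (S : list V) (c : V) (r : nat -> V) : Prop :=
  exists k, forall n, (k <= n)%nat -> same_comp S c (r n).

Definition equiv_rays (r1 r2 : nat -> V) : Prop :=
  forall S : list V, exists c, tail_in_comp S c r1 /\ tail_in_comp S c r2.

Definition is_end (E : (nat -> V) -> Prop) : Prop :=
  exists r0, ray r0 /\ forall r, E r <-> (ray r /\ equiv_rays r0 r).

Definition in_C (S : list V) (E : (nat -> V) -> Prop) (x : V) : Prop :=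
  exists r, E r /\ tail_in_comp S x r.

(* Points of |H|: points of the 1-complex are given by barycentric
   coordinates f : V -> R (a vertex, or an inner point of an edge);
   ends are given by their equivalence class of rays. *)
Inductive point : Type :=
  | Pt : (V -> R) -> point
  | End : ((nat -> V) -> Prop) -> point.

Definition is_vertex_pt (v : V) (f : V -> R) : Prop :=
  f v = 1 /\ forall w, w <> v -> f w = 0.

Definition is_edge_pt (u v : V) (f : V -> R) : Prop :=
  adj u v /\ 0 < f u < 1 /\ f v = 1 - f u /\
  forall w, w <> u -> w <> v -> f w = 0.

Definition carrier (x : point) : Prop :=
  match x with
  | Pt f => (exists v, is_vertex_pt v f) \/ (exists u v, is_edge_pt u v f)
  | End E => is_end E
  end.

Definition basic_nbhd (x : point) (N : point -> Prop) : Prop :=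
  match x with
  | Pt f =>
      (exists v eps, is_vertex_pt v f /\ 0 < eps <= 1 /\
         forall y, N y <-> exists g, y = Pt g /\
           (is_vertex_pt v g \/ exists w, is_edge_pt v w g /\ g v > 1 - eps))
   \/ (exists u v eps, is_edge_pt u v f /\ 0 < eps /\
         forall y, N y <-> exists g, y = Pt g /\
           is_edge_pt u v g /\ Rabs (g u - f u) < eps)
  | End E =>
      exists S : list V, forall y, N y <->
        match y with
        | Pt g => (exists w, is_vertex_pt w g /\ in_C S E w)
               \/ (exists u v, is_edge_pt u v g /\
                     (in_C S E u \/ In u S) /\ in_C S E v)
        | End E' => is_end E' /\ exists r, E' r /\
                      exists k, forall n, (k <= n)%nat -> in_C S E (r n)
        end
  end.

Definition open_FH (O : point -> Prop) : Prop :=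
  forall x, O x -> carrier x /\
    exists N, basic_nbhd x N /\ forall y, N y -> O y.
End Freudenthal.

Definition S1 := { p : R * R | fst p ^ 2 + snd p ^ 2 = 1 }.

Definition S1_dist (p q : S1) : R :=
  sqrt ((fst (proj1_sig p) - fst (proj1_sig q)) ^ 2 +
        (snd (proj1_sig p) - snd (proj1_sig q)) ^ 2).

Definition open_S1 (U : S1 -> Prop) : Prop :=
  forall p, U p -> exists eps, 0 < eps /\ forall q, S1_dist p q < eps -> U q.

Definition embedding_S1 {V : Type} (adj : graph V) (f : S1 -> point V) : Prop :=
  (forall p, carrier V adj (f p)) /\
  (forall p q, f p = f q -> p = q) /\
  (forall O, open_FH V adj O -> open_S1 (fun p => O (f p))) /\
  (forall U, open_S1 U -> exists O, open_FH V adj O /\ forall p, U p <-> O (f p)).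

Definition hamiltonian_circle {V : Type} (adj : graph V) : Prop :=
  exists C : point V -> Prop,
    (exists f : S1 -> point V, embedding_S1 adj f /\
       forall x, C x <-> exists p, f p = x) /\
    (forall v, exists g, is_vertex_pt V v g /\ C (Pt V g)).

Arguments simple_graph {V} adj.
Arguments locally_finite {V} adj.
Arguments connected {V} adj.
Arguments graph_square {V} adj _ _.

(* Main.v *)
(** A normal spanning tree T of G separates G as a finite tree would: the subtree
    T_v above a vertex v is connected and its neighbours lie among the finitely many
    ancestors of v.  So, for a vertex v running up a branch of T, the prisms T_v x K_2
    shrink to an end of the prism over G^2, and every end arises in this way.

    Each T_v x K_2 is traversed by a path "from (v, s) to (v, 1-s)" which visits the
    prisms over the subtrees of the children of v one after the other, each of them
    switching the level; siblings, and a vertex and its grandchildren, are adjacent in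
    the square.  If the number of children is even, the level comes out wrong, and the
    first child c is opened up: its two vertices and the subtrees of its children are
    inserted separately, in an order that depends on the parity of the number of
    children of c.

    Substituting these patterns into each other forever and placing the pieces in nested
    intervals gives a curve on [-1, 3]: its points are vertices, inner points of edges
    between consecutive pieces, and, for an infinite descending sequence of pieces, ends.
    The edge from (r, 1) back to (r, 0) at the root r closes it to a circle. *)

Require Import Defs.
From Stdlib Require Import Reals List Relations ClassicalEpsilon.
From Stdlib Require Import FunctionalExtensionality PropExtensionality Lia Lra Arith Cantor.
Import ListNotations.

Open Scope nat_scope.

(** Every prism over a child's subtree is left on the level opposite to the one it was entered on,
    so the number of children decides the level on which their parent is regained. An odd number is
    right, no children are handled by the vertical edge, and a positive even number is the obstacle.
    Opening one child c leaves an odd number of siblings, and its two vertices can be met in two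
    ways, so that the children of c start on whichever level their own parity requires.

    The embedding rests on two local estimates on parameters, one for the curve and one for its
    inverse. At an end, the first needs deep subtrees to miss any given finite set, which holds
    because each nesting step increases the depth. The second needs a finite set that cuts off such
    a subtree even in the square; ancestors alone can be jumped over there, so their neighbours are
    deleted as well.

    The interval [-1, 3] has length 4 because it unrolls two half circles, each projected onto an
    interval of length 2. *)

Lemma least_nat (P : nat -> Prop) :
  (exists n, P n) -> exists n, P n /\ forall m, P m -> n <= m.
Proof.
  intros [n Hn]. revert Hn. induction n as [n IH] using lt_wf_ind. intros Hn.
  destruct (classic (exists m, P m /\ m < n)) as [[m [Pm Lm]]|No].
  - exact (IH m Lm Pm).
  - exists n; split; auto. intros m Pm. destruct (le_lt_dec n m); auto.
    exfalso; apply No; eauto.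
Qed.

(** * Normal spanning trees *)

Section NormalTree.
Variables (V : Type) (adj : graph V).
Hypothesis adj_sym : forall u v, adj u v -> adj v u.

(** The length is recorded because the choice of tree vertices is steered by shortest walks. *)
Inductive walk (A : list V) : nat -> V -> V -> Prop :=
| walk_nil x : ~ In x A -> walk A 0 x x
| walk_cons n x y z : ~ In x A -> adj x y -> walk A n y z -> walk A (S n) x z.

Lemma walk_start A n x y : walk A n x y -> ~ In x A.
Proof. destruct 1; auto. Qed.

Lemma walk_end A n x y : walk A n x y -> ~ In y A.
Proof. induction 1; auto. Qed.

Lemma walk_app A n m x y z : walk A n x y -> walk A m y z -> walk A (n + m) x z.
Proof. induction 1; simpl; auto. intros; econstructor; eauto. Qed.

Lemma walk_rev A n x y : walk A n x y -> walk A n y x.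
Proof.
  induction 1 as [|n x y z Hx Hxy W IH]; [constructor; auto|].
  replace (S n) with (n + 1) by lia. eapply walk_app; eauto.
  econstructor; [eapply walk_start; eauto|eauto|constructor; auto].
Qed.

Definition comp (A : list V) (x y : V) : Prop := exists n, walk A n x y.

Lemma comp_refl A x : ~ In x A -> comp A x x.
Proof. exists 0; constructor; auto. Qed.

Lemma comp_sym A x y : comp A x y -> comp A y x.
Proof. intros [n W]; exists n; apply walk_rev; auto. Qed.

Lemma comp_trans A x y z : comp A x y -> comp A y z -> comp A x z.
Proof. intros [n W] [m W']; exists (n + m); eapply walk_app; eauto. Qed.

Lemma comp_end A x y : comp A x y -> ~ In y A.
Proof. intros [n W]; eapply walk_end; eauto. Qed.

Lemma comp_adj A x y : ~ In x A -> ~ In y A -> adj x y -> comp A x y.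
Proof. exists 1; econstructor; eauto; constructor; auto. Qed.

(** Equality as predicates, not mere equivalence: [pick A (comp A x)] is an [epsilon] choice and is
    literally the same vertex for all x of one component only if its argument is. *)
Lemma comp_eq A x y : comp A x y -> comp A x = comp A y.
Proof.
  intros C. apply functional_extensionality; intros z.
  apply propositional_extensionality; split; intros;
    eapply comp_trans; eauto using comp_sym.
Qed.

Lemma walk_uncons A c n x y : walk (c :: A) n x y -> walk A n x y.
Proof. induction 1; [constructor|econstructor]; eauto; intros ?; apply H; right; auto. Qed.

Lemma comp_uncons A c x y : comp (c :: A) x y -> comp A x y.
Proof. intros [n W]; exists n; eapply walk_uncons; eauto. Qed.

(* The vertex z precedes the first visit of the walk to c. *)
Lemma walk_hit A c n x y :
  walk A n x y -> x <> c ->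
  walk (c :: A) n x y \/ exists z, adj c z /\ comp (c :: A) x z.
Proof.
  induction 1 as [x Hx|n x y z Hx Hxy W IH]; intros Nc.
  - left; constructor; simpl; intuition congruence.
  - destruct (classic (y = c)) as [->|Ny].
    + right; exists x; split; auto. apply comp_refl; simpl; intuition congruence.
    + destruct (IH Ny) as [W'|[w [Hw C]]].
      * left; econstructor; eauto; simpl; intuition congruence.
      * right; exists w; split; auto. eapply comp_trans; eauto.
        apply walk_start in W. apply comp_adj; simpl; intuition congruence.
Qed.

Variable idx : V -> nat.
Hypothesis idx_inj : forall u v, idx u = idx v -> u = v.

Definition least_of (D : V -> Prop) (w : V) : Prop :=
  D w /\ forall y, D y -> idx w <= idx y.

Definition attached (A : list V) (c : V) : Prop :=
  match A with [] => True | h :: _ => adj h c end.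

Definition candidate (A : list V) (D : V -> Prop) (c : V) (d : nat) : Prop :=
  D c /\ attached A c /\ exists w, least_of D w /\ walk A d c w.

(** Heading for the least vertex of the component by a shortest walk is what makes the tree
    spanning; with arbitrary choices a branch could run to infinity and leave vertices behind. *)
Definition picks (A : list V) (D : V -> Prop) (c : V) : Prop :=
  exists d, candidate A D c d /\ forall c' d', candidate A D c' d' -> d <= d'.

Lemma least_of_exists (D : V -> Prop) x : D x -> exists w, least_of D w.
Proof.
  intros Dx. destruct (least_nat (fun n => exists y, D y /\ idx y = n)) as [n [[w [Dw <-]] Hn]].
  - eauto.
  - exists w; split; auto. intros y Dy; apply Hn; eauto.
Qed.

Lemma candidate_exists A x c :
  comp A x c -> attached A c -> exists d, candidate A (comp A x) c d.
Proof.
  intros C At. destruct (least_of_exists (comp A x) c C) as [w [Cw Lw]].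
  destruct (comp_trans _ _ _ _ (comp_sym _ _ _ C) Cw) as [d W].
  exists d. split; [|split]; auto. exists w; repeat split; auto.
Qed.

Lemma picks_exists A D c d : candidate A D c d -> exists c', picks A D c'.
Proof.
  intros H. destruct (least_nat (fun n => exists y, candidate A D y n)) as [n [[c' H'] Hn]].
  - eauto.
  - exists c', n; split; auto. intros c2 d2 H2; apply Hn; eauto.
Qed.

Variable o : V.

Definition pick (A : list V) (D : V -> Prop) : V := epsilon (inhabits o) (picks A D).

(* [on A x]: the list A, nearest first, is an initial segment of the path from the root
   to x in the spanning tree; the next vertex is picked from the
   component of x in G - A. *)
Inductive on : list V -> V -> Prop :=
| on_nil x : on [] x
| on_cons A x : on A x -> ~ In x A -> on (pick A (comp A x) :: A) x.

(** A next vertex exists because the previous one, c, lies in the component of x: on a walk from x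
    to c, the vertex just before the first visit to c is a neighbour of c that is still connected to
    x. *)
Lemma on_picks A x :
  on A x -> ~ In x A -> picks A (comp A x) (pick A (comp A x)).
Proof.
  induction 1 as [x|A x Ho IH Hx'].
  - intros _. apply (epsilon_spec (inhabits o) (picks _ _)).
    destruct (candidate_exists [] x x) as [d Hd]; simpl; auto using comp_refl.
    eapply picks_exists; eauto.
  - specialize (IH Hx'). set (c := pick A (comp A x)) in *. intros Hx.
    apply (epsilon_spec (inhabits o) (picks _ _)). destruct IH as [d [[[n W] _] _]].
    destruct (walk_hit A c n x c W) as [W'|[z [Hz Cz]]].
    + simpl in Hx; intuition.
    + exfalso; apply (walk_end _ _ _ _ W'); left; auto.
    + destruct (candidate_exists (c :: A) x z) as [d' Hd]; simpl; auto.
      eapply picks_exists; eauto.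
Qed.

Lemma on_inv c A x : on (c :: A) x -> on A x /\ ~ In x A /\ c = pick A (comp A x).
Proof. inversion 1; subst; auto. Qed.

Lemma on_comp A x y : on A x -> comp A x y -> on A y.
Proof.
  induction 1 as [x|A x Ho IH Hx]; intros C; [constructor|].
  apply comp_uncons in C. rewrite (comp_eq _ _ _ C). constructor; auto.
  eapply comp_end; eauto.
Qed.

(** The picked vertex c lies in the component of x, so each choice made on the way to x is also the
    one made on the way to c. *)
Lemma on_head c A x : on (c :: A) x -> on (c :: A) c /\ ~ In c A.
Proof.
  intros H. destruct (on_inv _ _ _ H) as [H1 [H2 H3]].
  pose proof (on_picks A x H1 H2) as [d [[C _] _]]. rewrite <- H3 in C.
  assert (N : ~ In c A) by (eapply comp_end; eauto). split; auto.
  rewrite H3 at 1. rewrite (comp_eq _ _ _ C). constructor; auto. eapply on_comp; eauto.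
Qed.

Lemma on_det A B x : on A x -> on B x -> length A = length B -> A = B.
Proof.
  intros H; revert B. induction H as [x|A x H IH Hx]; intros B HB L.
  - destruct B; simpl in *; auto; lia.
  - destruct B as [|b B]; simpl in L; [lia|].
    destruct (on_inv _ _ _ HB) as [H1 [H2 H3]].
    assert (A = B) by (apply IH; auto; lia). subst; auto.
Qed.

Lemma on_suffix A B x : on (A ++ B) x -> on B x.
Proof. induction A; simpl; auto. intros H; apply on_inv in H; intuition. Qed.

Lemma on_le A B x : on A x -> on B x -> length A <= length B -> exists C, B = C ++ A.
Proof.
  intros HA HB L. exists (firstn (length B - length A) B).
  rewrite <- (firstn_skipn (length B - length A) B) in HB.
  apply on_suffix in HB.
  rewrite <- (firstn_skipn (length B - length A) B) at 1. f_equal.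
  symmetry. eapply on_det; eauto. rewrite length_skipn; lia.
Qed.

Lemma on_self_unique A B x : on (x :: A) x -> on (x :: B) x -> A = B.
Proof.
  assert (H : forall A B, on (x :: A) x -> on (x :: B) x -> length A <= length B -> A = B).
  { clear A B; intros A B HA HB L.
    destruct (on_le _ _ _ HA HB) as [C E]; simpl; [lia|].
    destruct C as [|c C]; simpl in E; [congruence|].
    injection E as -> E. exfalso. apply on_inv in HB. destruct HB as [_ [HB _]].
    apply HB. rewrite E. apply in_or_app; simpl; auto. }
  intros HA HB. destruct (le_ge_dec (length A) (length B)); auto. symmetry; auto.
Qed.

(* The index of the least vertex of the component of x increases unless that
   vertex is reached, and until then its distance to the attachment set drops. *)
Lemma on_spanning x : exists A, on (x :: A) x.
Proof.
  enough (H : forall k d A c w, on A x -> ~ In x A -> candidate A (comp A x) c d ->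
            least_of (comp A x) w -> idx x - idx w <= k -> exists A, on (x :: A) x).
  { destruct (candidate_exists [] x x) as [d Hd]; simpl; auto using comp_refl.
    destruct (least_of_exists (comp [] x) x) as [w Hw]; [apply comp_refl; auto|].
    exact (H _ d [] x w (on_nil x) (fun F => F) Hd Hw (le_n _)). }
  induction k as [k IHk] using lt_wf_ind.
  induction d as [d IHd] using lt_wf_ind. intros A c w Ho Hx Hc Hw Hk.
  pose proof (on_picks A x Ho Hx) as [e [[Ce [At [w' [Hw' W]]]] Min]].
  assert (w' = w). { destruct Hw, Hw'. apply idx_inj. apply Nat.le_antisymm; auto. }
  subst w'. clear Hw'.
  assert (He : e <= d) by eauto.
  set (p := pick A (comp A x)) in *.
  assert (Hon : on (p :: A) x) by (constructor; auto). clearbody p.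
  destruct (classic (x = p)) as [->|Np]; [exists A; auto|].
  assert (Hx' : ~ In x (p :: A)) by (simpl; intuition).
  pose proof (on_picks _ _ Hon Hx') as [d2 [H2 Min2]].
  destruct (least_of_exists (comp (p :: A) x) x) as [w2 Hw2]; [apply comp_refl; auto|].
  assert (L2 : idx w <= idx w2).
  { apply Hw. destruct Hw2 as [Hw2 _]. eapply comp_uncons; eauto. }
  assert (Lx : idx w2 <= idx x) by (apply Hw2; apply comp_refl; auto).
  destruct (Nat.eq_dec (idx w) (idx w2)) as [E|NE].
  2:{ eapply (IHk (idx x - idx w2)); eauto. lia. }
  apply idx_inj in E. subst w2.
  assert (Nw : w <> p).
  { intros ->. destruct Hw2 as [C _]. apply comp_end in C. simpl in C; intuition. }
  inversion W as [? ?|n ? y ? ? Hpy W']; subst; [congruence|].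
  (* The second vertex y of a shortest walk from p to w is adjacent to p, hence a candidate for the
     next choice, at a distance one smaller. *)
  assert (Hd2 : d2 <= n); [|eapply (IHd d2); eauto; lia].
  destruct (classic (y = p)) as [->|Ny].
  { exfalso. assert (S n <= n); [|lia]. eapply Min. repeat split; eauto. }
  (* a shortest walk from p does not return to p *)
  assert (Wy : walk (p :: A) n y w).
  { assert (G : forall m z, walk A m z w -> m <= n -> walk (p :: A) m z w).
    { induction m as [|m IHm]; intros z Wz L; inversion Wz; subst.
      - constructor; simpl; intuition congruence.
      - econstructor; eauto; [|apply IHm; auto; lia].
        simpl. intros [<-|]; auto.
        assert (S n <= S m); [|lia]. eapply Min. repeat split; eauto. }
    apply G; auto. }
  apply (Min2 y n). split; [|split].
  - apply comp_trans with w; [apply Hw2|]. apply comp_sym. exists n; exact Wy.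
  - simpl; auto.
  - exists w; auto.
Qed.

Definition ancestors (x : V) : list V := epsilon (inhabits []) (fun A => on (x :: A) x).

Lemma ancestors_on x : on (x :: ancestors x) x.
Proof. unfold ancestors; apply epsilon_spec, on_spanning. Qed.

Lemma ancestors_cases x :
  (ancestors x = [] /\ x = pick [] (comp [] x)) \/
  exists p, ancestors x = p :: ancestors p /\ adj p x.
Proof.
  pose proof (ancestors_on x) as H. destruct (ancestors x) as [|p A] eqn:E.
  - left; split; auto. apply on_inv in H; intuition.
  - right; exists p. apply on_inv in H. destruct H as [H [Hx E2]]. split.
    + f_equal. apply on_head in H. destruct H as [H _].
      eapply on_self_unique; [exact H|apply ancestors_on].
    + pose proof (on_picks _ _ H Hx) as [d [[_ [At _]] _]]. rewrite <- E2 in At. exact At.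
Qed.

(** If y is not on the path to x, the edge keeps y in the component from which x was picked. The
    tree path to y then runs through x, so x is an ancestor of y. *)
Lemma ancestors_normal x y : adj x y -> In x (y :: ancestors y) \/ In y (x :: ancestors x).
Proof.
  intros Hxy. apply NNPP. intros N.
  assert (Ny : ~ In y (x :: ancestors x)) by tauto. assert (Nx : ~ In x (y :: ancestors y)) by tauto.
  pose proof (ancestors_on x) as Hx. pose proof (ancestors_on y) as Hy.
  destruct (on_inv _ _ _ Hx) as [H1 [H2 H3]].
  assert (C : comp (ancestors x) x y).
  { apply comp_adj; auto. simpl in Ny; intuition. }
  assert (H4 : on (x :: ancestors x) y).
  { rewrite H3 at 1. rewrite (comp_eq _ _ _ C). constructor.
    - eapply on_comp; eauto.
    - eapply comp_end; eauto. }
  destruct (le_ge_dec (length (x :: ancestors x)) (length (y :: ancestors y))) as [L|L].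
  - destruct (on_le _ _ _ H4 Hy L) as [D E]. apply Nx. rewrite E.
    apply in_or_app; simpl; auto.
  - destruct (on_le _ _ _ Hy H4 L) as [D E]. apply Ny. rewrite E.
    apply in_or_app; simpl; auto.
Qed.
End NormalTree.

(** * Countability and the resulting normal spanning tree *)

Lemma pointwise_choice {A B : Type} (P : A -> B -> Prop) :
  (forall a, exists b, P a b) -> exists f, forall a, P a (f a).
Proof.
  intros H. exists (fun a => proj1_sig (constructive_indefinite_description _ (H a))).
  intros a. apply proj2_sig.
Qed.

Lemma locally_finite_countable (V : Type) (adj : graph V) :
  locally_finite adj -> connected adj -> V ->
  exists idx : V -> nat, forall u v, idx u = idx v -> u = v.
Proof.
  intros LF Co o. destruct (pointwise_choice _ LF) as [nb Hnb].
  (* Finite balls around o exhaust a connected graph; a vertex is coded by a radius and a position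
     in the list for that ball. *)
  set (ball := fix ball n := match n with 0 => [o] | S n => flat_map nb (ball n) end).
  assert (Hb : forall v, exists n, In v (ball n)).
  { intros v. pose proof (Co o v) as P. apply clos_rt_rtn1 in P.
    induction P as [|u v Huv _ [n IH]]; [exists 0; simpl; auto|].
    exists (S n). simpl. apply in_flat_map. eauto. }
  assert (Hc : forall v, exists c : nat * nat, nth_error (ball (fst c)) (snd c) = Some v).
  { intros v. destruct (Hb v) as [n Hn]. apply In_nth_error in Hn. destruct Hn as [i Hi].
    exists (n, i); auto. }
  destruct (pointwise_choice _ Hc) as [code Hcode].
  exists (fun v => to_nat (code v)). intros u v E.
  apply to_nat_inj in E. pose proof (Hcode u). pose proof (Hcode v). congruence.
Qed.

Lemma normal_spanning_tree (V : Type) (adj : graph V) :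
  (forall u v, adj u v -> adj v u) -> locally_finite adj -> connected adj -> V ->
  exists (r : V) (up : V -> list V),
    up r = [] /\
    (forall x, x = r \/ exists p, up x = p :: up p /\ adj p x) /\
    (forall x y, adj x y -> In x (y :: up y) \/ In y (x :: up x)).
Proof.
  intros Sy LF Co o. destruct (locally_finite_countable V adj LF Co o) as [idx Hidx].
  assert (Con : forall x y, comp V adj [] x y).
  { intros x y. pose proof (Co x y) as P. induction P.
    - apply comp_adj; simpl; auto.
    - apply comp_refl; simpl; auto.
    - eapply comp_trans; eauto. }
  set (up := ancestors V adj idx o).
  set (r := pick V adj idx o [] (comp V adj [] o)).
  assert (R : forall x, comp V adj [] x = comp V adj [] o) by (intros; apply comp_eq; auto).
  exists r, up. split; [|split].
  - pose proof (ancestors_on V adj Sy idx Hidx o r) as H.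
    assert (H0 : on V adj idx o [r] r).
    { unfold r at 1. rewrite <- (R r). constructor; [constructor|simpl; auto]. }
    symmetry. eapply on_self_unique; eauto.
  - intros x. destruct (ancestors_cases V adj Sy idx Hidx o x) as [[_ E]|H]; auto.
    left. unfold r. rewrite E, R. reflexivity.
  - apply ancestors_normal; auto.
Qed.

Close Scope nat_scope.

(** * Neighbourhoods in the Freudenthal compactification *)

Section Topology.
Variables (X : Type) (adj : graph X).
Hypothesis adj_sym : forall u v, adj u v -> adj v u.
Hypothesis adj_irrefl : forall u v, adj u v -> u <> v.
Local Open Scope R_scope.

Local Notation same_comp := (same_comp X adj).
Local Notation tail_in_comp := (tail_in_comp X adj).
Local Notation equiv_rays := (equiv_rays X adj).
Local Notation ray := (ray X adj).
Local Notation is_end := (is_end X adj).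
Local Notation in_C := (in_C X adj).
Local Notation carrier := (carrier X adj).
Local Notation basic_nbhd := (basic_nbhd X adj).

Lemma same_comp_refl S x : ~ In x S -> same_comp S x x.
Proof. repeat split; auto. apply rt_refl. Qed.

Lemma same_comp_sym S x y : same_comp S x y -> same_comp S y x.
Proof.
  intros (H1 & H2 & P). repeat split; auto. clear H1 H2.
  induction P as [x y (A & B & C)|x|x y z]; [apply rt_step; auto|apply rt_refl|].
  eapply rt_trans; eauto.
Qed.

Lemma same_comp_trans S x y z : same_comp S x y -> same_comp S y z -> same_comp S x z.
Proof. intros (H1 & H2 & P) (H3 & H4 & Q). repeat split; auto. eapply rt_trans; eauto. Qed.

Lemma same_comp_adj S x y : adj x y -> ~ In x S -> ~ In y S -> same_comp S x y.
Proof. intros; repeat split; auto. apply rt_step; auto. Qed.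

Lemma ray_leaves r (S : list X) : ray r -> exists k, forall n, (k <= n)%nat -> ~ In (r n) S.
Proof.
  intros [Inj _]. induction S as [|s S [k IH]].
  - exists 0%nat; auto.
  - destruct (classic (exists m, r m = s)) as [[m Hm]|N].
    + exists (max k (1 + m)). intros n L [E|I].
      * assert (m = n) by (apply Inj; congruence). lia.
      * apply (IH n); auto; lia.
    + exists k. intros n L [E|I]; [apply N; eauto|]. apply (IH n); auto.
Qed.

Lemma ray_tail r S : ray r ->
  exists k, forall n, (k <= n)%nat -> tail_in_comp S (r n) r.
Proof.
  intros R. destruct (ray_leaves r S R) as [k H]. exists k.
  assert (G : forall m, same_comp S (r k) (r (k + m)%nat)).
  { induction m as [|m IH]; [rewrite Nat.add_0_r; apply same_comp_refl; auto|].
    eapply same_comp_trans; [exact IH|]. rewrite Nat.add_succ_r.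
    apply same_comp_adj; [apply R| |]; apply H; lia. }
  assert (G' : forall m, (k <= m)%nat -> same_comp S (r k) (r m)).
  { intros m L. replace m with (k + (m - k))%nat by lia; auto. }
  intros n L. exists k. intros m L'. eapply same_comp_trans; [apply same_comp_sym|]; eauto.
Qed.

Lemma equiv_rays_refl r : ray r -> equiv_rays r r.
Proof. intros R S. destruct (ray_tail r S R) as [k H]. exists (r k); auto. Qed.

Lemma tail_comp S x y r : tail_in_comp S x r -> tail_in_comp S y r -> same_comp S x y.
Proof.
  intros [k H] [m H']. eapply same_comp_trans; [apply (H (max k m)); lia|].
  apply same_comp_sym, H'; lia.
Qed.

Lemma tail_moves S x y r : same_comp S x y -> tail_in_comp S y r -> tail_in_comp S x r.
Proof. intros C [k H]. exists k. intros n L. eapply same_comp_trans; eauto. Qed.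

Lemma tail_equiv S x r r' : equiv_rays r r' -> tail_in_comp S x r -> tail_in_comp S x r'.
Proof.
  intros E T. destruct (E S) as (c & H & H'). eapply tail_moves; [|exact H'].
  eapply tail_comp; eauto.
Qed.

Lemma equiv_rays_sym r r' : equiv_rays r r' -> equiv_rays r' r.
Proof. intros E S. destruct (E S) as (c & H & H'); eauto. Qed.

Lemma equiv_rays_trans r1 r2 r3 : equiv_rays r1 r2 -> equiv_rays r2 r3 -> equiv_rays r1 r3.
Proof.
  intros E E' S. destruct (E S) as (c & H & H'). exists c; split; auto.
  eapply tail_equiv; eauto.
Qed.

Lemma end_ray E : is_end E -> exists r, E r.
Proof. intros (r & R & H). exists r. apply H; split; auto. apply equiv_rays_refl; auto. Qed.

Lemma end_equiv E r r' : is_end E -> E r -> E r' -> equiv_rays r r'.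
Proof.
  intros (r0 & _ & H) A B. apply H in A, B. eapply equiv_rays_trans; [apply equiv_rays_sym, A|apply B].
Qed.

(** All rays of an end are equivalent, so any single one decides membership in the component. *)
Lemma in_C_tail S E r x : is_end E -> E r -> (in_C S E x <-> tail_in_comp S x r).
Proof.
  intros I Er; split.
  - intros (r' & Er' & T). eapply tail_equiv; [|exact T]. eapply end_equiv; eauto.
  - intros T; exists r; auto.
Qed.

Lemma in_C_eventually S E r : is_end E -> E r ->
  exists k, forall n, (k <= n)%nat -> in_C S E (r n).
Proof.
  intros I Er. assert (R : ray r) by (destruct I as (r0 & _ & H); apply H, Er).
  destruct (ray_tail r S R) as [k H]. exists k. intros n L. exists r; auto.
Qed.

Lemma in_C_notin S E x : in_C S E x -> ~ In x S.
Proof. intros (r & _ & k & H). apply (H k (le_n _)). Qed.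

Lemma in_C_same S E x y : in_C S E y -> same_comp S x y -> in_C S E x.
Proof. intros (r & Er & T) C. exists r; split; auto. eapply tail_moves; eauto. Qed.

Lemma edge_pt_flip u v f : is_edge_pt X adj u v f -> is_edge_pt X adj v u f.
Proof.
  intros (A & B & C & D). split; [auto|]. split; [lra|]. split; [lra|]. auto.
Qed.

Lemma basic_nbhd_center x N : carrier x -> basic_nbhd x N -> N x.
Proof.
  destruct x as [f|E]; intros C B.
  - destruct B as [(v & eps & V & _ & H)|(u & v & eps & Ed & P & H)]; apply H; exists f.
    + auto.
    + split; [reflexivity|]. split; [exact Ed|]. rewrite Rminus_diag, Rabs_R0; auto.
  - destruct B as [S H]. apply H. split; auto. destruct (end_ray E C) as [r Er].
    exists r; split; auto. apply in_C_eventually; auto.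
Qed.

Lemma vertex_edge_excl v u w f : is_vertex_pt X v f -> is_edge_pt X adj u w f -> False.
Proof.
  intros [H1 H2] (_ & H3 & _). destruct (classic (u = v)) as [->|N]; [|apply H2 in N]; lra.
Qed.

(** This makes unions of basic neighbourhoods open in the sense of [open_FH], which is how the open
    sets of the embedding are produced. *)
Lemma basic_nbhd_open x N y : carrier x -> basic_nbhd x N -> N y ->
  carrier y /\ exists N', basic_nbhd y N' /\ forall z, N' z -> N z.
Proof.
  destruct x as [f|E]; intros C B Ny.
  - destruct B as [(v & eps & Vf & P & H)|(u & v & eps & Ed & P & H)];
      apply H in Ny; destruct Ny as (g & -> & G).
    + destruct G as [G|(w & G & L)].
      * split; [left; eauto|]. exists N; split; auto. left. exists v, eps; auto.
      * split; [right; eauto|].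
        exists (fun y => exists h, y = Pt X h /\ is_edge_pt X adj v w h /\
                         Rabs (h v - g v) < g v - (1 - eps)).
        split.
        { right. exists v, w, (g v - (1 - eps)). repeat split; try apply G; auto; lra. }
        intros z (h & -> & Hh & L'). apply H. exists h; split; auto. right.
        exists w; split; auto. apply Rabs_def2 in L'. lra.
    + destruct G as [G L]. split; [right; eauto|].
      exists (fun y => exists h, y = Pt X h /\ is_edge_pt X adj u v h /\
                         Rabs (h u - g u) < eps - Rabs (g u - f u)).
      split.
      { right. exists u, v, (eps - Rabs (g u - f u)). repeat split; try apply G; auto; lra. }
      intros z (h & -> & Hh & L'). apply H. exists h; split; auto. split; auto.
      replace (h u - f u) with ((h u - g u) + (g u - f u)) by ring.
      eapply Rle_lt_trans; [apply Rabs_triang|lra].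
  - destruct B as [S H]. pose proof Ny as Ny'. apply H in Ny. destruct y as [g|E'].
    + destruct Ny as [(w & G & I)|(u & v & G & Iu & Iv)].
      * split; [left; eauto|].
        (* The whole open star of w, with radius 1, fits: the other end of an edge at w lies in S or
           in the component of w. *)
        exists (fun y => exists h, y = Pt X h /\ (is_vertex_pt X w h \/
                  exists w', is_edge_pt X adj w w' h /\ h w > 1 - 1)).
        split; [left; exists w, 1; repeat split; try apply G; auto; lra|].
        intros z (h & -> & [Hh|(w' & Hh & _)]); apply H; [left; eauto|].
        right. exists w', w. split; [apply edge_pt_flip; auto|]. split; auto.
        destruct (classic (In w' S)) as [I'|I']; auto. left.
        eapply in_C_same; [exact I|]. apply same_comp_adj; auto; [apply adj_sym, Hh|].
        eapply in_C_notin; eauto.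
      * split; [right; eauto|].
        exists (fun y => exists h, y = Pt X h /\ is_edge_pt X adj u v h /\
                         Rabs (h u - g u) < 1).
        split; [right; exists u, v, 1; repeat split; try apply G; auto; lra|].
        intros z (h & -> & Hh & _). apply H. right; exists u, v; auto.
    + destruct Ny as [I' (r & Er & k & T)]. split; [exact I'|].
      set (Q := fun E z => match z with
        | Pt _ g => (exists w, is_vertex_pt X w g /\ in_C S E w)
               \/ (exists u v, is_edge_pt X adj u v g /\
                     (in_C S E u \/ In u S) /\ in_C S E v)
        | End _ E' => is_end E' /\ exists r, E' r /\
                      exists k, forall n, (k <= n)%nat -> in_C S E (r n)
        end).
      (* The same S works for E': a ray of E' eventually lies in the components of both ends, so
         these coincide. *)
      assert (M : forall x, in_C S E' x -> in_C S E x).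
      { intros x Ix. destruct (in_C_eventually S E' r I' Er) as [m Hm].
        specialize (T (max k m) ltac:(lia)). specialize (Hm (max k m) ltac:(lia)).
        eapply in_C_same; [exact T|]. apply (in_C_tail S E' r) in Ix, Hm; auto.
        eapply tail_comp; eauto. }
      exists (Q E'). split; [exists S; intros y; destruct y; reflexivity|].
      intros z Qz. apply H. destruct z as [h|E2]; simpl in *.
      * destruct Qz as [(w & A & B)|(u & v & A & B & D)]; [left; eauto|].
        right; exists u, v. intuition.
      * destruct Qz as [A (r2 & B & m & D)]. split; auto. exists r2; split; auto.
        exists m; auto.
Qed.

(** The parameter t is the fraction of the edge already covered on the way from x to y. *)
Definition edge_point (x y : X) (t : R) : X -> R :=
  fun w => if excluded_middle_informative (w = x) then 1 - t
           else if excluded_middle_informative (w = y) then t else 0.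

Definition vertex_point (x : X) : X -> R :=
  fun w => if excluded_middle_informative (w = x) then 1 else 0.

Lemma vertex_point_vertex x : is_vertex_pt X x (vertex_point x).
Proof.
  unfold vertex_point; split; [destruct (excluded_middle_informative (x = x)); congruence|].
  intros w N; destruct (excluded_middle_informative (w = x)); congruence.
Qed.

Lemma vertex_point_inv x v : is_vertex_pt X v (vertex_point x) -> v = x.
Proof.
  intros [H _]. unfold vertex_point in H. destruct (excluded_middle_informative (v = x)); auto. lra.
Qed.

Lemma edge_point_left x y t : edge_point x y t x = 1 - t.
Proof. unfold edge_point. destruct (excluded_middle_informative (x = x)); congruence. Qed.

Lemma edge_point_right x y t : x <> y -> edge_point x y t y = t.
Proof.
  unfold edge_point.
  destruct (excluded_middle_informative (y = x)), (excluded_middle_informative (y = y)); congruence.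
Qed.

Lemma edge_point_other x y t w : w <> x -> w <> y -> edge_point x y t w = 0.
Proof.
  unfold edge_point.
  destruct (excluded_middle_informative (w = x)), (excluded_middle_informative (w = y)); congruence.
Qed.

Lemma edge_point_edge x y t : adj x y -> 0 < t < 1 -> is_edge_pt X adj x y (edge_point x y t).
Proof.
  intros A T. repeat split; auto; rewrite ?edge_point_left, ?edge_point_right; auto; try lra.
  intros w; apply edge_point_other.
Qed.

Lemma edge_point_inv x y t u v : x <> y -> 0 < t < 1 -> is_edge_pt X adj u v (edge_point x y t) ->
  u = x /\ v = y \/ u = y /\ v = x.
Proof.
  intros N T (A & B & C & D).
  assert (Hu : u = x \/ u = y).
  { apply NNPP; intros Q. rewrite edge_point_other in B; [lra| |]; tauto. }
  assert (Hv : v = x \/ v = y).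
  { apply NNPP; intros Q. rewrite (edge_point_other _ _ _ v) in C; [lra| |]; tauto. }
  apply adj_irrefl in A. destruct Hu, Hv; subst; intuition congruence.
Qed.
End Topology.

(** * Paths through the prisms over subtrees *)

Section Expansion.
Local Open Scope nat_scope.
Variables (V : Type) (adj : graph V).
Hypothesis adj_sym : forall u v, adj u v -> adj v u.
Hypothesis adj_lf : locally_finite adj.
Variables (r : V) (up : V -> list V).
Hypothesis up_root : up r = [].
Hypothesis up_step : forall x, x = r \/ exists p, up x = p :: up p /\ adj p x.

Definition sub (v x : V) : Prop := In v (x :: up x).

(** * The tree order *)

Lemma up_ind (P : V -> Prop) :
  P r -> (forall p x, up x = p :: up p -> adj p x -> P p -> P x) -> forall x, P x.
Proof.
  intros Pr Ps x. remember (length (up x)) as n eqn:E. revert x E.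
  induction n as [|n IH]; intros x E; destruct (up_step x) as [->|[p [Hp Ap]]]; auto.
  - rewrite Hp in E; discriminate.
  - eapply Ps; eauto. apply IH. rewrite Hp in E; simpl in E; congruence.
Qed.

Lemma up_length y x : In y (up x) -> length (up y) < length (up x).
Proof.
  revert y; pattern x; apply up_ind; clear x.
  - rewrite up_root; simpl; tauto.
  - intros p x Hx _ IH y Hy. rewrite Hx in *. simpl in *.
    destruct Hy as [->|Hy]; [lia|]. apply IH in Hy; lia.
Qed.

Lemma sub_refl v : sub v v.
Proof. left; auto. Qed.

Lemma sub_length v x : sub v x -> length (up v) <= length (up x).
Proof. intros [->|H]; auto. apply up_length in H; lia. Qed.

Lemma sub_step p v x : up x = p :: up p -> (sub v x <-> v = x \/ sub v p).
Proof. unfold sub; intros ->; simpl; intuition congruence. Qed.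

Lemma sub_root x : sub r x.
Proof.
  pattern x; apply up_ind; clear x; [apply sub_refl|].
  intros p x Hx _ IH. apply (sub_step p); auto.
Qed.

Lemma sub_trans u v x : sub u v -> sub v x -> sub u x.
Proof.
  intros Huv. pattern x; apply up_ind; clear x.
  - intros [<-|H]; auto. rewrite up_root in H; destruct H.
  - intros p x Hx _ IH H. apply (sub_step p _ _ Hx) in H. destruct H as [->|H]; auto.
    apply (sub_step p); auto.
Qed.

Lemma sub_antisym u v : sub u v -> sub v u -> u = v.
Proof. intros [H|H] H'; auto. apply up_length in H. apply sub_length in H'. lia. Qed.

Lemma sub_total u v x : sub u x -> sub v x -> sub u v \/ sub v u.
Proof.
  pattern x; apply up_ind; clear x.
  - unfold sub at 1 2. rewrite up_root. simpl. intros [<-|[]] [<-|[]]. left; apply sub_refl.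
  - intros p x Hx _ IH Hu Hv. pose proof Hu as Hu'. pose proof Hv as Hv'.
    apply (sub_step p _ _ Hx) in Hu'. apply (sub_step p _ _ Hx) in Hv'.
    destruct Hu' as [->|Hu']; auto. destruct Hv' as [->|Hv']; auto.
Qed.

Definition child (v c : V) : Prop := up c = v :: up v.

Lemma child_adj v c : child v c -> adj v c.
Proof.
  unfold child; intros H. destruct (up_step c) as [->|[p [Hp A]]].
  - rewrite up_root in H; discriminate.
  - congruence.
Qed.

Lemma child_sub v c : child v c -> sub v c.
Proof. unfold sub; intros ->; simpl; auto. Qed.

Lemma child_not_sub v c : child v c -> ~ sub c v.
Proof. intros H H'. apply sub_length in H'. rewrite H in H'. simpl in H'; lia. Qed.

Lemma child_neq v c : child v c -> v <> c.
Proof. intros H <-. apply (child_not_sub _ _ H), sub_refl. Qed.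

Lemma sub_cases v x : sub v x -> v = x \/ exists c, child v c /\ sub c x.
Proof.
  pattern x; apply up_ind; clear x.
  - intros [<-|H]; auto. rewrite up_root in H; destruct H.
  - intros p x Hx _ IH H. apply (sub_step p _ _ Hx) in H. destruct H as [->|H]; auto.
    right. destruct (IH H) as [->|[c [Hc S]]].
    + exists x; split; auto. apply sub_refl.
    + exists c; split; auto. apply (sub_step p); auto.
Qed.

Lemma child_unique v c c' x : child v c -> child v c' -> sub c x -> sub c' x -> c = c'.
Proof.
  intros H H' S S'.
  enough (G : forall c c', child v c -> child v c' -> sub c c' -> c = c').
  { destruct (sub_total _ _ _ S S'); [|symmetry]; auto. }
  clear c c' H H' S S'. intros c c' H H' S.
  apply (sub_step v _ _ H') in S. destruct S as [|S]; auto.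
  destruct (child_not_sub _ _ H S).
Qed.

Lemma NoDup_extension (P : V -> Prop) (l : list V) :
  (forall c, P c -> In c l) -> exists l', NoDup l' /\ forall c, In c l' <-> P c.
Proof.
  revert P. induction l as [|a l IH]; intros P H.
  - exists []; split; [constructor|]. intros c; split; [intros []|apply H].
  - destruct (IH (fun c => P c /\ c <> a)) as [l' [N Hl]].
    { intros c [Pc Ne]. destruct (H c Pc); [congruence|auto]. }
    destruct (classic (P a)) as [Pa|Na].
    + exists (a :: l'); split.
      * constructor; auto. rewrite Hl; tauto.
      * intros c; simpl; rewrite Hl. destruct (classic (a = c)) as [<-|]; intuition congruence.
    + exists l'; split; auto. intros c; rewrite Hl. intuition congruence.
Qed.

Lemma children_exist v : exists l, NoDup l /\ forall c, In c l <-> child v c.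
Proof.
  destruct (adj_lf v) as [l Hl]. apply (NoDup_extension _ l).
  intros c Hc; apply Hl, child_adj, Hc.
Qed.

Definition hadj : graph (V * bool) := box_K2 (graph_square adj).

Lemma hadj_sym x y : hadj x y -> hadj y x.
Proof.
  intros [[E [N [A|[w [A B]]]]]|[E N]].
  - left; split; auto; split; auto.
  - left; split; auto; split; auto. right; eauto.
  - right; split; auto.
Qed.

Lemma hadj_irrefl x y : hadj x y -> x <> y.
Proof. intros [[_ [N _]]|[_ N]] ->; auto. Qed.

Lemma hadj_child v c s : child v c -> hadj (v, s) (c, s).
Proof.
  intros H; left; split; auto; split; [apply child_neq; auto|].
  left; apply child_adj; auto.
Qed.

Lemma hadj_sibling v c d s : child v c -> child v d -> c <> d -> hadj (c, s) (d, s).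
Proof.
  intros H H' N; left; split; auto; split; auto.
  right; exists v; auto using child_adj.
Qed.

Lemma hadj_grandchild v c d s : child v c -> child c d -> hadj (v, s) (d, s).
Proof.
  intros H H'; left; split; auto; split.
  - simpl; intros ->. apply (child_not_sub _ _ H), child_sub, H'.
  - right; exists c; auto using child_adj.
Qed.

Lemma hadj_vertical v s : hadj (v, s) (v, negb s).
Proof. right; split; auto. destruct s; discriminate. Qed.

(* A block [Bk v s] stands for a path through all vertices of the prism over the
   subtree at v, from (v, s) to (v, negb s). *)
Inductive item := Vt (x : V * bool) | Bk (v : V) (s : bool).

Definition first (i : item) : V * bool := match i with Vt x => x | Bk v s => (v, s) end.
Definition final (i : item) : V * bool := match i with Vt x => x | Bk v s => (v, negb s) end.
Definition covers (i : item) (x : V * bool) : Prop :=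
  match i with Vt y => x = y | Bk v _ => sub v (fst x) end.
Definition disjoint (i j : item) : Prop := forall x, ~ (covers i x /\ covers j x).

Fixpoint traverses (x : V * bool) (l : list item) (y : V * bool) : Prop :=
  match l with
  | [] => x = y
  | i :: l => hadj x (first i) /\ traverses (final i) l y
  end.

Lemma traverses_app x l y l' z :
  traverses x l y -> traverses y l' z -> traverses x (l ++ l') z.
Proof.
  revert x; induction l as [|i l IH]; simpl; intros x; [intros ->; auto|].
  intros [H T] T'; auto.
Qed.

(** The two copies of v are left out of [mid] because they fix where the piece begins and ends.
    [exp_blocks] lets an infinite nesting be read as a ray: the roots of successive blocks are at
    distance at most 2 in the graph. *)
Record expansion (v : V) (s : bool) (mid : list item) : Prop := {
  exp_traverses : traverses (v, s) (mid ++ [Vt (v, negb s)]) (v, negb s);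
  exp_covers : forall x, sub v (fst x) <->
    exists i, In i (Vt (v, s) :: mid ++ [Vt (v, negb s)]) /\ covers i x;
  exp_disjoint : ForallOrdPairs disjoint (Vt (v, s) :: mid ++ [Vt (v, negb s)]);
  exp_blocks : forall c b, In (Bk c b) mid ->
    child v c \/ exists w, child v w /\ child w c
}.

Fixpoint alternate (s : bool) (cs : list V) : list item :=
  match cs with [] => [] | c :: cs => Bk c s :: alternate (negb s) cs end.

Lemma in_alternate s cs i :
  In i (alternate s cs) -> exists c b, In c cs /\ i = Bk c b.
Proof.
  revert s; induction cs as [|c cs IH]; simpl; intros s; [tauto|].
  intros [<-|H]; eauto. destruct (IH _ H) as [d [b [Hd ->]]]; eauto.
Qed.

Lemma alternate_in s cs c : In c cs -> exists b, In (Bk c b) (alternate s cs).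
Proof.
  revert s; induction cs as [|d cs IH]; simpl; intros s; [tauto|].
  intros [->|H]; eauto. destruct (IH (negb s) H); eauto.
Qed.

Lemma alternate_disjoint v s cs :
  NoDup cs -> (forall c, In c cs -> child v c) -> ForallOrdPairs disjoint (alternate s cs).
Proof.
  intros N; revert s; induction N as [|c cs Hc N IH]; simpl; intros s H; constructor; auto.
  apply Forall_forall; intros i Hi. apply in_alternate in Hi.
  destruct Hi as [d [b [Hd ->]]]. intros x [C D]; simpl in *.
  assert (c = d) by (eapply (child_unique v); eauto). congruence.
Qed.

Definition flip (s : bool) (cs : list V) : bool := xorb s (Nat.odd (length cs)).

Lemma flip_cons s c cs : flip s (c :: cs) = flip (negb s) cs.
Proof.
  unfold flip. simpl length. rewrite Nat.odd_succ, <- Nat.negb_odd.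
  destruct s, (Nat.odd _); auto.
Qed.

(** The entry vertex u may be the parent or a sibling visited separately, so that the lemma serves
    both the patterns that go straight from v to the children and the one that visits c first. *)
Lemma alternate_traverses v s cs u :
  NoDup cs -> (forall c, In c cs -> child v c) -> u = v \/ (child v u /\ ~ In u cs) ->
  exists u', traverses (u, s) (alternate s cs) (u', flip s cs) /\
    (cs = [] /\ u' = u \/ In u' cs).
Proof.
  intros N; revert s u; induction N as [|c cs Hc N IH]; intros s u H Hu.
  - exists u; simpl; split; auto. unfold flip; simpl. destruct s; auto.
  - destruct (IH (negb s) c) as [u' [T Hu']].
    + intros d Hd; apply H; right; auto.
    + right; split; auto. apply H; left; auto.
    + exists u'. rewrite flip_cons. simpl. split; [split; auto|].
      * assert (Cc : child v c) by (apply H; left; auto).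
        destruct Hu as [->|[Hu Nu]]; [apply hadj_child; auto|].
        apply (hadj_sibling v); auto. intros ->; apply Nu; left; auto.
      * right. destruct Hu' as [[_ ->]|]; auto.
Qed.

Lemma ForallOrdPairs_app {A : Type} (R : A -> A -> Prop) l l' :
  ForallOrdPairs R l -> ForallOrdPairs R l' ->
  (forall a b, In a l -> In b l' -> R a b) -> ForallOrdPairs R (l ++ l').
Proof.
  induction 1 as [|a l Ha Hl IH]; simpl; auto. intros H' C. constructor; auto.
  apply Forall_app; split; auto. apply Forall_forall; auto.
Qed.

Lemma disjoint_Vt x y : x <> y -> disjoint (Vt x) (Vt y).
Proof. intros N z [A B]; simpl in *; congruence. Qed.
Lemma disjoint_Vt_Bk x c b : ~ sub c (fst x) -> disjoint (Vt x) (Bk c b).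
Proof. intros N z [A B]; simpl in *; subst; auto. Qed.
Lemma disjoint_Bk_Vt x c b : ~ sub c (fst x) -> disjoint (Bk c b) (Vt x).
Proof. intros N z [A B]; simpl in *; subst; auto. Qed.

Lemma covers_sub i x : covers i x -> sub (fst (first i)) (fst x).
Proof. destruct i; simpl; auto. intros ->; apply sub_refl. Qed.

Lemma bool_cases (b s : bool) : b = s \/ b = negb s.
Proof. destruct b, s; auto. Qed.

Lemma vertex_pair_cases (v : V) s (x : V * bool) : v = fst x -> x = (v, s) \/ x = (v, negb s).
Proof.
  intros E. destruct x as [w b]; simpl in E; subst. destruct (bool_cases b s); subst; auto.
Qed.

Lemma neq_negb (v : V) s : (v, s) <> (v, negb s).
Proof. destruct s; discriminate. Qed.

Lemma neq_negb' (v : V) s : (v, negb s) <> (v, s).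
Proof. destruct s; discriminate. Qed.

Lemma neq_vertex (v w : V) (a b : bool) : v <> w -> (v, a) <> (w, b).
Proof. congruence. Qed.

Lemma ForallOrdPairs_singleton {A : Type} (R : A -> A -> Prop) a : ForallOrdPairs R [a].
Proof. repeat constructor. Qed.

Lemma expansion_simple v s cs :
  NoDup cs -> (forall c, In c cs <-> child v c) -> cs = [] \/ flip s cs = negb s ->
  expansion v s (alternate s cs).
Proof.
  intros N Hcs F.
  assert (Hc : forall c, In c cs -> child v c) by (intros; apply Hcs; auto).
  constructor.
  - destruct (alternate_traverses v s cs v) as [u [T Hu]]; auto.
    eapply traverses_app; [exact T|]. simpl; split; auto.
    destruct Hu as [[-> ->]|Hu].
    + unfold flip; simpl. rewrite Bool.xorb_false_r. apply hadj_vertical.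
    + destruct F as [->|F]; [destruct Hu|]. rewrite F. apply hadj_sym, hadj_child; auto.
  - intros x; split.
    + intros S. destruct (sub_cases _ _ S) as [E|[c [C S']]].
      * destruct (vertex_pair_cases v s x E) as [->| ->].
        -- exists (Vt (v, s)); simpl; auto.
        -- exists (Vt (v, negb s)); split; [|simpl; auto].
           right; apply in_or_app; right; left; auto.
      * apply Hcs in C. destruct (alternate_in s cs c C) as [b Hb].
        exists (Bk c b); split; auto. right; apply in_or_app; auto.
    + intros [i [Hi C]]. apply covers_sub in C. eapply sub_trans; [|exact C].
      destruct Hi as [<-|Hi]; [apply sub_refl|].
      apply in_app_or in Hi; destruct Hi as [Hi|[<-|[]]]; [|apply sub_refl].
      apply in_alternate in Hi. destruct Hi as [d [b [Hd ->]]]. apply child_sub; auto.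
  - constructor.
    + apply Forall_app; split; [|repeat constructor; apply disjoint_Vt, neq_negb].
      apply Forall_forall; intros i Hi. apply in_alternate in Hi.
      destruct Hi as [d [b [Hd ->]]]. apply disjoint_Vt_Bk, child_not_sub; auto.
    + apply ForallOrdPairs_app; [eapply alternate_disjoint; eauto|apply ForallOrdPairs_singleton|].
      intros i j Hi [<-|[]]. apply in_alternate in Hi.
      destruct Hi as [d [b [Hd ->]]]. apply disjoint_Bk_Vt, child_not_sub; auto.
  - intros c b H. apply in_alternate in H. destruct H as [d [b' [Hd E]]].
    injection E as -> _; auto.
Qed.

(* The two vertices of c are visited separately, which allows its children ds to
   correct the parity. *)
Lemma expansion_even v s c cs ds X Y t :
  NoDup (c :: cs) -> (forall d, In d (c :: cs) <-> child v d) ->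
  NoDup ds -> (forall d, In d ds <-> child c d) ->
  (X = [Vt (c, s)] /\ Y = [] /\ t = negb s \/ X = [] /\ Y = [Vt (c, s)] /\ t = s) ->
  flip s cs = negb s -> flip t ds = negb s ->
  expansion v s (X ++ alternate s cs ++ Vt (c, negb s) :: Y ++ alternate t ds).
Proof.
  intros N Hcs Nd Hds XY Fc Fd.
  assert (Hc : forall d, In d cs -> child v d) by (intros; apply Hcs; right; auto).
  assert (Cc : child v c) by (apply Hcs; left; auto).
  assert (Hd : forall d, In d ds -> child c d) by (intros; apply Hds; auto).
  inversion N as [|? ? Nc N']; subst.
  assert (HX : forall i, In i X -> i = Vt (c, s)).
  { intros i Hi. destruct XY as [[-> _]|[-> _]]; [destruct Hi as [<-|[]]|destruct Hi]; auto. }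
  assert (HY : forall i, In i Y -> i = Vt (c, s)).
  { intros i Hi. destruct XY as [[_ [-> _]]|[_ [-> _]]]; [destruct Hi|destruct Hi as [<-|[]]]; auto. }
  assert (Ncs : forall d, In d cs -> ~ sub d c).
  { intros d Id S. assert (d = c); [|congruence].
    apply (child_unique v d c c); auto using sub_refl. }
  constructor.
  - assert (TD : forall b, exists u, traverses (c, b) (alternate b ds) (u, flip b ds) /\
       (ds = [] /\ u = c \/ In u ds)) by (intros; apply (alternate_traverses c); auto).
    assert (Fin : forall u, (ds = [] /\ u = c \/ In u ds) -> hadj (u, negb s) (v, negb s)).
    { intros u [[_ ->]|Hu]; apply hadj_sym; [apply hadj_child; auto|].
      apply (hadj_grandchild v c); auto. }
    destruct XY as [[-> [-> ->]]|[-> [-> ->]]].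
    (* Order: (v, s), (c, s), the siblings from level s to the other level, (c, 1-s), then an even
       number of children of c, which return to that level. *)
    + destruct (alternate_traverses v s cs c) as [u [T Hu]]; auto.
      destruct (TD (negb s)) as [w [Tw Hw]]. simpl. split; [apply hadj_child; auto|].
      rewrite <- app_assoc. eapply traverses_app; [exact T|]. rewrite Fc. simpl. split.
      (* By [Fc] the list [cs] has odd length, so it is not empty and u is a sibling of c. *)
      * destruct Hu as [[-> _]|Hu]; [destruct s; discriminate|].
        apply (hadj_sibling v); auto. congruence.
      * eapply traverses_app; [exact Tw|]. rewrite Fd. simpl; auto.
    (* Order: (v, s), the siblings, (c, 1-s), down to (c, s), then an odd number of children of c,
       which end on level 1-s. *)
    + destruct (alternate_traverses v s cs v) as [u [T Hu]]; auto.
      destruct (TD s) as [w [Tw Hw]]. simpl.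
      rewrite <- app_assoc. eapply traverses_app; [exact T|]. rewrite Fc. simpl. split.
      * destruct Hu as [[-> _]|Hu]; [destruct s; discriminate|].
        apply (hadj_sibling v); auto. congruence.
      * split; [apply hadj_sym, hadj_vertical|].
        eapply traverses_app; [exact Tw|]. rewrite Fd. simpl; auto.
  - intros x; split.
    + intros S. destruct (sub_cases _ _ S) as [E|[d [C S']]].
      * destruct (vertex_pair_cases v s x E) as [->| ->].
        -- exists (Vt (v, s)); simpl; auto.
        -- exists (Vt (v, negb s)); split; [|simpl; auto].
           right; apply in_or_app; right; left; auto.
      * apply Hcs in C. destruct C as [<-|C].
        -- destruct (sub_cases _ _ S') as [E|[e [C S'']]].
           ++ destruct (vertex_pair_cases c s x E) as [->| ->].
              ** exists (Vt (c, s)); split; [|simpl; auto]. right.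
                 apply in_or_app; left.
                 destruct XY as [[-> _]|[_ [-> _]]]; [left; auto|].
                 apply in_or_app; right; apply in_or_app; right; right; left; auto.
              ** exists (Vt (c, negb s)); split; [|simpl; auto]. right.
                 apply in_or_app; left. apply in_or_app; right.
                 apply in_or_app; right; left; auto.
           ++ apply Hds in C. destruct (alternate_in t ds e C) as [b Hb].
              exists (Bk e b); split; auto. right.
              apply in_or_app; left. apply in_or_app; right.
              apply in_or_app; right; right. apply in_or_app; auto.
        -- destruct (alternate_in s cs d C) as [b Hb].
           exists (Bk d b); split; auto. right.
           apply in_or_app; left. apply in_or_app; right. apply in_or_app; auto.
    + intros [i [Hi C]]. apply covers_sub in C. eapply sub_trans; [|exact C].
      assert (Sc : sub v c) by (apply child_sub; auto).
      destruct Hi as [<-|Hi]; [apply sub_refl|].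
      apply in_app_or in Hi; destruct Hi as [Hi|[<-|[]]]; [|apply sub_refl].
      apply in_app_or in Hi; destruct Hi as [Hi|Hi]; [apply HX in Hi; subst; auto|].
      apply in_app_or in Hi; destruct Hi as [Hi|[<-|Hi]]; auto.
      { apply in_alternate in Hi. destruct Hi as [d [b [Id ->]]]. apply child_sub; auto. }
      apply in_app_or in Hi; destruct Hi as [Hi|Hi]; [apply HY in Hi; subst; auto|].
      apply in_alternate in Hi. destruct Hi as [d [b [Id ->]]].
      eapply sub_trans; [exact Sc|apply child_sub; simpl; auto].
  - assert (Nvc : forall a b, (v, a) <> (c, b)) by (intros; apply neq_vertex, child_neq; auto).
    assert (Ncv : forall a b, (c, a) <> (v, b)) by (intros a b E; apply (Nvc b a); auto).
    assert (Nd1 : forall d, In d ds -> ~ sub d v).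
    { intros d Id S. apply (child_not_sub _ _ Cc).
      eapply sub_trans; [apply child_sub, Hd, Id|auto]. }
    assert (Nd2 : forall d, In d ds -> ~ sub d c) by (intros; apply child_not_sub; auto).
    assert (Nd3 : forall d, In d cs -> ~ sub d v) by (intros; apply child_not_sub; auto).
    assert (Nd4 : forall d e a b, In d cs -> In e ds -> disjoint (Bk d a) (Bk e b)).
    { intros d e a b Id Ie x [A B]; simpl in *. apply Nc.
      replace c with d; auto. apply (child_unique v d c (fst x)); auto.
      eapply sub_trans; [apply child_sub, Hd, Ie|auto]. }
    assert (FX : ForallOrdPairs disjoint X).
    { destruct XY as [[-> _]|[-> _]]; repeat constructor. }
    assert (FY : ForallOrdPairs disjoint Y).
    { destruct XY as [[_ [-> _]]|[_ [-> _]]]; repeat constructor. }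
    assert (XYe : X = [] \/ Y = []) by (destruct XY as [[_ [-> _]]|[-> _]]; auto).
    change (Vt (v, s) :: ?l) with ([Vt (v, s)] ++ l).
    apply ForallOrdPairs_app; [apply ForallOrdPairs_singleton| |].
    { apply ForallOrdPairs_app; [|apply ForallOrdPairs_singleton|].
      { apply ForallOrdPairs_app; [auto| |].
        { apply ForallOrdPairs_app; [eapply alternate_disjoint; eauto| |].
          { change (Vt (c, negb s) :: ?l) with ([Vt (c, negb s)] ++ l).
            apply ForallOrdPairs_app; [apply ForallOrdPairs_singleton| |].
            { apply ForallOrdPairs_app; [auto|eapply alternate_disjoint; eauto|].
              intros i j Hi Hj. apply HY in Hi; subst. apply in_alternate in Hj.
              destruct Hj as [d [b [Id ->]]]. apply disjoint_Vt_Bk; simpl; auto. }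
            intros i j [<-|[]] Hj. apply in_app_or in Hj. destruct Hj as [Hj|Hj].
            { apply HY in Hj; subst. apply disjoint_Vt, neq_negb'. }
            apply in_alternate in Hj. destruct Hj as [d [b [Id ->]]].
            apply disjoint_Vt_Bk; simpl; auto. }
          intros i j Hi Hj. apply in_alternate in Hi. destruct Hi as [d [b [Id ->]]].
          destruct Hj as [<-|Hj]; [apply disjoint_Bk_Vt; simpl; auto|].
          apply in_app_or in Hj. destruct Hj as [Hj|Hj].
          { apply HY in Hj; subst. apply disjoint_Bk_Vt; simpl; auto. }
          apply in_alternate in Hj. destruct Hj as [e [b' [Ie ->]]]; auto. }
        intros i j Hi Hj. destruct XYe as [E|E]; [rewrite E in Hi; destruct Hi|].
        apply HX in Hi; subst i. rewrite E in Hj.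
        apply in_app_or in Hj; destruct Hj as [Hj|[<-|Hj]];
          [|apply disjoint_Vt, neq_negb|];
          apply in_alternate in Hj; destruct Hj as [d [b [Id ->]]];
          apply disjoint_Vt_Bk; simpl; auto. }
      intros i j Hi [<-|[]].
      apply in_app_or in Hi; destruct Hi as [Hi|Hi].
      { apply HX in Hi; subst. apply disjoint_Vt; auto. }
      apply in_app_or in Hi; destruct Hi as [Hi|[<-|Hi]]; [|apply disjoint_Vt; auto|].
      { apply in_alternate in Hi; destruct Hi as [d [b [Id ->]]].
        apply disjoint_Bk_Vt; simpl; auto. }
      apply in_app_or in Hi; destruct Hi as [Hi|Hi].
      { apply HY in Hi; subst. apply disjoint_Vt; auto. }
      apply in_alternate in Hi; destruct Hi as [d [b [Id ->]]].
      apply disjoint_Bk_Vt; simpl; auto. }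
    intros i j [<-|[]] Hj.
    apply in_app_or in Hj; destruct Hj as [Hj|[<-|[]]]; [|apply disjoint_Vt, neq_negb].
    apply in_app_or in Hj; destruct Hj as [Hj|Hj].
    { apply HX in Hj; subst. apply disjoint_Vt; auto. }
    apply in_app_or in Hj; destruct Hj as [Hj|[<-|Hj]]; [|apply disjoint_Vt; auto|].
    { apply in_alternate in Hj; destruct Hj as [d [b [Id ->]]].
      apply disjoint_Vt_Bk; simpl; auto. }
    apply in_app_or in Hj; destruct Hj as [Hj|Hj].
    { apply HY in Hj; subst. apply disjoint_Vt; auto. }
    apply in_alternate in Hj; destruct Hj as [d [b [Id ->]]].
    apply disjoint_Vt_Bk; simpl; auto.
  - intros d b Hi.
    apply in_app_or in Hi; destruct Hi as [Hi|Hi]; [apply HX in Hi; discriminate|].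
    apply in_app_or in Hi; destruct Hi as [Hi|[Hi|Hi]]; [|discriminate|].
    { apply in_alternate in Hi. destruct Hi as [e [b' [Id E]]]. injection E as -> _; auto. }
    apply in_app_or in Hi; destruct Hi as [Hi|Hi]; [apply HY in Hi; discriminate|].
    apply in_alternate in Hi. destruct Hi as [e [b' [Id E]]]. injection E as -> _; eauto.
Qed.

Lemma expansion_exists v s : exists mid, expansion v s mid.
Proof.
  destruct (children_exist v) as [cs [N Hcs]].
  destruct (Bool.bool_dec (flip s cs) (negb s)) as [F|F].
  - eexists; apply expansion_simple; eauto.
  - destruct cs as [|c cs]; [eexists; apply (expansion_simple v s []); auto|].
    destruct (children_exist c) as [ds [Nd Hds]]. rewrite flip_cons in F.
    (* Without c an odd number of children remains. *)
    assert (Fc : flip s cs = negb s).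
    { unfold flip in *. destruct s, (Nat.odd (length cs)); simpl in *; congruence. }
    (* An odd number of children of c must start on level s, so (c, s) is visited last of the two
       copies; an even number must start on the other level, so (c, s) is visited first. *)
    destruct (Bool.bool_dec (flip s ds) (negb s)) as [G|G].
    + eexists. apply (expansion_even v s c cs ds [] [Vt (c, s)] s); auto.
    + eexists. apply (expansion_even v s c cs ds [Vt (c, s)] [] (negb s)); auto.
      unfold flip in *. destruct s, (Nat.odd (length ds)); simpl in *; congruence.
Qed.

Definition mid (v : V) (s : bool) : list item :=
  proj1_sig (constructive_indefinite_description _ (expansion_exists v s)).

Lemma mid_expansion v s : expansion v s (mid v s).
Proof. unfold mid; apply proj2_sig. Qed.

(** * Placing the pieces in nested intervals *)

Local Open Scope R_scope.

Record entry := Ent { it : item; lo : R; hi : R }.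

(** Consecutive items start w apart. A block fills only half of its step: the other half is left for
    an edge, and block lengths are at least halved from level to level. *)
Fixpoint place (a w : R) (l : list item) : list entry :=
  match l with
  | [] => []
  | i :: l => Ent i a (match i with Vt _ => a | Bk _ _ => a + w / 2 end) :: place (a + w) w l
  end.

(** There are two more items than in [mid], hence one more step than its length; the last vertex
    lands exactly on [hi e]. *)
Definition subdivide (e : entry) : list entry :=
  match it e with
  | Vt _ => [e]
  | Bk v s => place (lo e) ((hi e - lo e) / INR (S (length (mid v s))))
                (Vt (v, s) :: mid v s ++ [Vt (v, negb s)])
  end.

(** The vertex x and the position a are what has been reached so far. The strict inequality gives
    every edge an interval of positive length. *)
Fixpoint run (x : V * bool) (a : R) (l : list entry) (y : V * bool) (b : R) : Prop :=
  match l with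
  | [] => x = y /\ a = b
  | e :: l => hadj x (first (it e)) /\ a < lo e /\ lo e <= hi e /\
              run (final (it e)) (hi e) l y b
  end.

Lemma run_app x a l y b l' z c :
  run x a l y b -> run y b l' z c -> run x a (l ++ l') z c.
Proof.
  revert x a; induction l as [|e l IH]; simpl; intros x a; [intros [-> ->]; auto|].
  intros (H1 & H2 & H3 & H4) H; repeat split; eauto.
Qed.

Lemma run_app_inv x a l l' z c :
  run x a (l ++ l') z c -> exists y b, run x a l y b /\ run y b l' z c.
Proof.
  revert x a; induction l as [|e l IH]; simpl; intros x a; [intros H; exists x, a; auto|].
  intros (H1 & H2 & H3 & H4). destruct (IH _ _ H4) as (y & b & R1 & R2).
  exists y, b; repeat split; auto.
Qed.

Lemma run_in x a l y b : run x a l y b ->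
  a <= b /\ forall e, In e l -> a < lo e /\ lo e <= hi e /\ hi e <= b.
Proof.
  revert x a; induction l as [|e l IH]; simpl; intros x a.
  - intros [_ ->]; split; [lra|tauto].
  - intros (H1 & H2 & H3 & H4). destruct (IH _ _ H4) as [L I]. split; [lra|].
    intros e' [<-|H]; [lra|]. apply I in H; lra.
Qed.

Lemma run_ordered x a l y b : run x a l y b -> ForallOrdPairs (fun e e' => hi e < lo e') l.
Proof.
  revert x a; induction l as [|e l IH]; simpl; intros x a; constructor.
  - apply Forall_forall; intros e' H'. destruct H as (H1 & H2 & H3 & H4).
    apply (run_in _ _ _ _ _ H4); auto.
  - apply (IH (final (it e)) (hi e)), H.
Qed.

Lemma run_unique x a l y b e e' t : run x a l y b -> In e l -> In e' l ->
  lo e <= t <= hi e -> lo e' <= t <= hi e' -> e = e'.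
Proof.
  intros R1 I I' T T'. destruct (ForallOrdPairs_In (run_ordered _ _ _ _ _ R1) e e' I I') as [H|[H|H]];
    auto; lra.
Qed.

Definition gap_in (l : list entry) (x : V * bool) (a : R) (y : V * bool) (b : R) : Prop :=
  exists l1 e e' l2, l = l1 ++ e :: e' :: l2 /\
    x = final (it e) /\ a = hi e /\ y = first (it e') /\ b = lo e'.

Lemma run_gap x a l y b x' a' y' b' : run x a l y b -> gap_in l x' a' y' b' ->
  hadj x' y' /\ a' < b'.
Proof.
  intros R1 (l1 & e & e' & l2 & -> & -> & -> & -> & ->).
  apply run_app_inv in R1. destruct R1 as (z & c & _ & R1). simpl in R1. tauto.
Qed.

Lemma run_locate x a l y b t : run x a l y b -> a < t <= b ->
  (exists e, In e l /\ lo e <= t <= hi e) \/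
  (exists x' a' y' b', gap_in l x' a' y' b' /\ a' < t < b') \/
  (forall e, In e l -> t < lo e).
Proof.
  revert x a; induction l as [|e l IH]; simpl; intros x a.
  - intros [_ ->]; lra.
  - intros (H1 & H2 & H3 & H4) T.
    destruct (Rlt_le_dec t (lo e)) as [C|C].
    { right; right. intros e' [<-|I]; auto. apply (run_in _ _ _ _ _ H4) in I; lra. }
    destruct (Rle_lt_dec t (hi e)) as [D|D]; [left; exists e; auto|].
    destruct (IH _ _ H4) as [(e' & I & T')|[(x' & a' & y' & b' & G & T')|F]]; [lra| | |].
    + left; exists e'; auto.
    + right; left. exists x', a', y', b'; split; auto.
      destruct G as (l1 & f & f' & l2 & -> & G). exists (e :: l1), f, f', l2; auto.
    + destruct l as [|e' l]; [destruct H4; lra|].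
      right; left. exists (final (it e)), (hi e), (first (it e')), (lo e'). split.
      * exists [], e, e', l; auto.
      * split; [lra|apply F; left; auto].
Qed.

Lemma place_run l x a' a w z :
  traverses x (l ++ [Vt z]) z -> 0 < w -> a' < a ->
  run x a' (place a w (l ++ [Vt z])) z (a + INR (length l) * w).
Proof.
  revert x a' a; induction l as [|i l IH]; simpl place; intros x a' a T W A.
  - simpl in *. destruct T as [T _]. repeat split; auto; lra.
  - destruct T as [H T]. cbn [app place run it lo hi]. split; [auto|]. split; [auto|]. split.
    + destruct i; lra.
    + replace (a + INR (length (i :: l)) * w) with ((a + w) + INR (length l) * w)
        by (simpl length; rewrite S_INR; ring).
      apply IH; auto. destruct i; lra.
Qed.

Lemma place_in a w l e : 0 < w -> In e (place a w l) ->
  In (it e) l /\ a <= lo e /\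
  hi e = match it e with Vt _ => lo e | Bk _ _ => lo e + w / 2 end.
Proof.
  intros W; revert a; induction l as [|i l IH]; simpl; intros a; [tauto|].
  intros [<-|H]; simpl; [repeat split; auto; lra|].
  destruct (IH _ H) as (H1 & H2 & H3). repeat split; auto; lra.
Qed.

Lemma place_last a w l z :
  In (Ent (Vt z) (a + INR (length l) * w) (a + INR (length l) * w)) (place a w (l ++ [Vt z])).
Proof.
  revert a; induction l as [|i l IH]; simpl place; intros a.
  - left; simpl; f_equal; ring.
  - right. replace (a + INR (length (i :: l)) * w) with ((a + w) + INR (length l) * w)
      by (simpl length; rewrite S_INR; ring). apply IH.
Qed.

Lemma in_place a w l i : In i l -> exists e, In e (place a w l) /\ it e = i.
Proof.
  revert a; induction l as [|j l IH]; simpl; intros a; [tauto|].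
  intros [->|H]; [eexists; split; [left; eauto|auto]|].
  destruct (IH (a + w) H) as [e [He E]]; eauto.
Qed.

Lemma place_items a w l e : In e (place a w l) -> In (it e) l.
Proof.
  revert a; induction l as [|i l IH]; simpl; intros a; [tauto|].
  intros [<-|H]; eauto.
Qed.

Lemma place_pairs (P : item -> item -> Prop) a w l : ForallOrdPairs P l ->
  ForallOrdPairs (fun e e' => P (it e) (it e')) (place a w l).
Proof.
  intros F; revert a; induction F as [|i l Hi F IH]; simpl; intros a; constructor; auto.
  simpl. apply Forall_forall; intros e He. rewrite Forall_forall in Hi. apply Hi.
  eapply place_items; eauto.
Qed.

Definition proper (e : entry) : Prop :=
  match it e with Vt _ => lo e = hi e | Bk _ _ => lo e < hi e end.

Definition width (e : entry) : R :=
  match it e with Bk v s => (hi e - lo e) / INR (S (length (mid v s))) | _ => 0 end.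

Lemma width_bounds e v s : it e = Bk v s -> proper e ->
  0 < width e <= hi e - lo e /\ lo e + INR (S (length (mid v s))) * width e = hi e.
Proof.
  unfold proper, width; intros -> P. rewrite S_INR.
  pose proof (pos_INR (length (mid v s))). set (k := INR _) in *.
  assert (E : (k + 1) * ((hi e - lo e) / (k + 1)) = hi e - lo e) by (field; lra).
  assert (0 < (hi e - lo e) / (k + 1)) by (apply Rdiv_lt_0_compat; lra).
  split; [split; auto|lra]. nra.
Qed.

Lemma subdivide_Bk e v s : it e = Bk v s -> subdivide e = place (lo e) (width e)
  (Vt (v, s) :: mid v s ++ [Vt (v, negb s)]).
Proof. unfold subdivide, width; intros ->; auto. Qed.

Lemma subdivide_Vt e x : it e = Vt x -> subdivide e = [e].
Proof. unfold subdivide; intros ->; auto. Qed.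

Lemma subdivide_run e x a : proper e -> hadj x (first (it e)) -> a < lo e ->
  run x a (subdivide e) (final (it e)) (hi e).
Proof.
  intros P H A. destruct (it e) as [z|v s] eqn:E.
  - rewrite (subdivide_Vt _ _ E). unfold proper in P; simpl; rewrite E in *. simpl. repeat split; auto; lra.
  - rewrite (subdivide_Bk _ _ _ E). destruct (width_bounds _ _ _ E P) as [W <-].
    rewrite app_comm_cons.
    apply (place_run (Vt (v, s) :: mid v s)); try lra. simpl. split; auto.
    apply mid_expansion.
Qed.

Lemma subdivide_in e e' : proper e -> In e' (subdivide e) ->
  lo e <= lo e' /\ hi e' <= hi e /\ proper e' /\
  (forall x, covers (it e') x -> covers (it e) x).
Proof.
  intros P I. destruct (it e) as [z|v s] eqn:E.
  - rewrite (subdivide_Vt _ _ E) in I. destruct I as [<-|[]]. rewrite E; auto with real.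
  - assert (R1 : run (v, negb s) (lo e - 1) (subdivide e) (v, negb s) (hi e)).
    { pose proof (subdivide_run e (v, negb s) (lo e - 1) P) as H. rewrite E in H. apply H; [|lra].
      simpl. apply hadj_sym, hadj_vertical. }
    apply run_in in R1. destruct R1 as [_ R1]. specialize (R1 _ I).
    rewrite (subdivide_Bk _ _ _ E) in I. destruct (width_bounds _ _ _ E P) as [W _].
    apply place_in in I; [|lra]. destruct I as (I & L & H).
    repeat split; try lra.
    + unfold proper. destruct (it e'); lra.
    + intros x C. apply (exp_covers _ _ _ (mid_expansion v s)). eauto.
Qed.

Lemma subdivide_half e e' v s : it e' = Bk v s -> proper e -> proper e' -> In e' (subdivide e) ->
  hi e' - lo e' <= (hi e - lo e) / 2.
Proof.
  intros E' P P' I. destruct (it e) as [z|w b] eqn:E.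
  - rewrite (subdivide_Vt _ _ E) in I. destruct I as [<-|[]]. congruence.
  - rewrite (subdivide_Bk _ _ _ E) in I. destruct (width_bounds _ _ _ E P) as [W _].
    apply place_in in I; [|lra]. destruct I as (_ & _ & H). rewrite E' in H. lra.
Qed.

Lemma subdivide_ends e v s : it e = Bk v s -> proper e ->
  In (Ent (Vt (v, s)) (lo e) (lo e)) (subdivide e) /\
  In (Ent (Vt (v, negb s)) (hi e) (hi e)) (subdivide e).
Proof.
  intros E P. rewrite (subdivide_Bk _ _ _ E). destruct (width_bounds _ _ _ E P) as [W H]. split.
  - left; auto.
  - rewrite <- H. rewrite app_comm_cons. apply (place_last _ _ (Vt (v, s) :: mid v s)).
Qed.

Lemma subdivide_covers e x : proper e -> covers (it e) x ->
  exists e', In e' (subdivide e) /\ covers (it e') x.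
Proof.
  intros P C. destruct (it e) as [z|v s] eqn:E.
  - rewrite (subdivide_Vt _ _ E). exists e; rewrite E; simpl; auto.
  - rewrite (subdivide_Bk _ _ _ E). apply (exp_covers _ _ _ (mid_expansion v s)) in C.
    destruct C as (i & I & C). destruct (in_place (lo e) (width e) _ _ I) as (e' & I' & <-).
    eauto.
Qed.

Lemma subdivide_disjoint e e1 e2 x : In e1 (subdivide e) -> In e2 (subdivide e) ->
  covers (it e1) x -> covers (it e2) x -> e1 = e2.
Proof.
  intros I1 I2 C1 C2. destruct (it e) as [z|v s] eqn:E.
  - rewrite (subdivide_Vt _ _ E) in *. destruct I1 as [<-|[]], I2 as [<-|[]]; auto.
  - rewrite (subdivide_Bk _ _ _ E) in *.
    pose proof (place_pairs _ (lo e) (width e) _ (exp_disjoint _ _ _ (mid_expansion v s))) as F.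
    destruct (ForallOrdPairs_In F _ _ I1 I2) as [H|[H|H]]; auto; exfalso; eapply H; eauto.
Qed.

Lemma subdivide_block e e' v s c b : it e = Bk v s -> it e' = Bk c b -> proper e ->
  In e' (subdivide e) -> child v c \/ exists w, child v w /\ child w c.
Proof.
  intros E E' P I. rewrite (subdivide_Bk _ _ _ E) in I. destruct (width_bounds _ _ _ E P) as [W _].
  apply place_in in I; [|lra]. destruct I as (I & _). rewrite E' in I.
  destruct I as [I|I]; [discriminate|]. apply in_app_or in I.
  destruct I as [I|[I|[]]]; [|discriminate].
  eapply exp_blocks; [apply mid_expansion|]; eauto.
Qed.

Lemma run_subdivide l x a y b : (forall e, In e l -> proper e) ->
  run x a l y b -> run x a (flat_map subdivide l) y b.
Proof.
  revert x a; induction l as [|e l IH]; simpl; intros x a P; auto.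
  intros (H1 & H2 & H3 & H4). eapply run_app; [apply subdivide_run; auto|]. apply IH; auto.
Qed.

Fixpoint level (n : nat) : list entry :=
  match n with
  | O => [Ent (Bk r false) (-1) 1]
  | S n => flat_map subdivide (level n)
  end.

Lemma level_proper n e : In e (level n) -> proper e.
Proof.
  revert e; induction n as [|n IH]; simpl; intros e.
  - intros [<-|[]]. unfold proper; simpl; lra.
  - intros H. apply in_flat_map in H. destruct H as (d & D & I).
    apply (subdivide_in d); auto.
Qed.

(** The start at -2 is fictitious: it lets the invariant begin with an edge, the vertical one into
    [(r, false)]. *)
Lemma level_run n : run (r, true) (-2) (level n) (r, true) 1.
Proof.
  induction n as [|n IH]; simpl.
  - repeat split; try lra. apply hadj_sym, (hadj_vertical r false).
  - apply run_subdivide; auto. apply level_proper.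
Qed.

Lemma level_bounds n e : In e (level n) -> -1 <= lo e /\ lo e <= hi e /\ hi e <= 1.
Proof.
  intros H. pose proof (proj2 (run_in _ _ _ _ _ (level_run n)) e H).
  repeat split; try lra. clear H0.
  (* The fictitious start only gives a bound by -2; the bound by -1 comes from the nesting. *)
  revert e H; induction n as [|n IH]; simpl; intros e.
  - intros [<-|[]]. simpl; lra.
  - intros H. apply in_flat_map in H. destruct H as (d & D & I).
    apply subdivide_in in I; [|eapply level_proper; eauto]. specialize (IH _ D); lra.
Qed.

Lemma level_covers n x : exists e, In e (level n) /\ covers (it e) x.
Proof.
  induction n as [|n IH]; simpl.
  - eexists; split; [left; eauto|]. simpl. apply sub_root.
  - destruct IH as (e & I & C). destruct (subdivide_covers e x) as (e' & I' & C'); auto.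
    { eapply level_proper; eauto. }
    exists e'; split; auto. apply in_flat_map; eauto.
Qed.

Lemma level_disjoint n e e' x : In e (level n) -> In e' (level n) ->
  covers (it e) x -> covers (it e') x -> e = e'.
Proof.
  revert e e'; induction n as [|n IH]; simpl; intros e e'.
  - intros [<-|[]] [<-|[]]; auto.
  - intros H H' C C'. apply in_flat_map in H. apply in_flat_map in H'.
    destruct H as (d & D & I). destruct H' as (d' & D' & I').
    assert (d = d').
    { apply IH; auto; eapply subdivide_in; eauto; eapply level_proper; eauto. }
    subst. eapply subdivide_disjoint; eauto.
Qed.

(** Starting from depth 0 and length 2, each subdivision descends at least one generation and at
    least halves the length. *)
Lemma level_block n e v s : In e (level n) -> it e = Bk v s ->
  (n <= length (up v))%nat /\ hi e - lo e <= 2 / 2 ^ n.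
Proof.
  revert e v s; induction n as [|n IH]; intros e v s.
  - simpl. intros [<-|[]] E. injection E as <- <-. simpl; split; [lia|lra].
  - intros H E. pose proof (level_proper _ _ H) as P. simpl in H. apply in_flat_map in H.
    destruct H as (d & D & I). pose proof (level_proper _ _ D) as Pd.
    destruct (it d) as [z|w b] eqn:Ed.
    { rewrite (subdivide_Vt _ _ Ed) in I. destruct I as [<-|[]]; congruence. }
    destruct (IH _ _ _ D Ed) as [IH1 IH2].
    pose proof (subdivide_half _ _ _ _ E Pd P I) as W.
    split.
    + apply (subdivide_block _ _ _ _ _ _ Ed E Pd) in I. unfold child in I.
      destruct I as [->|(u & H1 & ->)]; [simpl; lia|]. simpl; rewrite H1; simpl; lia.
    + simpl pow. replace (2 / (2 * 2 ^ n)) with (2 / 2 ^ n / 2); [lra|].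
      field. apply pow_nonzero; lra.
Qed.

Lemma level_ancestor n k e : (n <= k)%nat -> In e (level k) ->
  exists d, In d (level n) /\ lo d <= lo e /\ hi e <= hi d /\
    forall x, covers (it e) x -> covers (it d) x.
Proof.
  intros L; revert e; induction L as [|k L IH]; intros e I.
  - exists e; repeat split; auto; lra.
  - simpl in I; apply in_flat_map in I. destruct I as (f & F & I).
    apply subdivide_in in I; [|eapply level_proper; eauto].
    destruct (IH _ F) as (d & D & H). exists d. intuition; lra.
Qed.

(** * The curve *)

(* The copy of [(r, false)] at position 3 is identified with the one at -1. *)
Definition cyc (n : nat) : list entry := level n ++ [Ent (Vt (r, false)) 3 3].

Lemma cyc_run n : run (r, true) (-2) (cyc n) (r, false) 3.
Proof.
  eapply run_app; [apply level_run|]. simpl. repeat split; try lra.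
  apply hadj_sym, (hadj_vertical r false).
Qed.

Lemma cyc_S n : cyc (S n) = flat_map subdivide (cyc n).
Proof. unfold cyc. rewrite flat_map_app. auto. Qed.

Lemma cyc_in n e : In e (cyc n) -> In e (level n) \/ e = Ent (Vt (r, false)) 3 3.
Proof. intros H; apply in_app_or in H; simpl in H; intuition. Qed.

Lemma cyc_proper n e : In e (cyc n) -> proper e.
Proof. intros H; apply cyc_in in H. destruct H as [H| ->]; [eapply level_proper; eauto|reflexivity]. Qed.

Lemma cyc_bounds n e : In e (cyc n) -> -1 <= lo e /\ lo e <= hi e /\ hi e <= 3.
Proof.
  intros H; apply cyc_in in H. destruct H as [H| ->]; [apply level_bounds in H; lra|simpl; lra].
Qed.

Lemma cyc_unique n e e' t : In e (cyc n) -> In e' (cyc n) ->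
  lo e <= t <= hi e -> lo e' <= t <= hi e' -> e = e'.
Proof. eapply run_unique, cyc_run. Qed.

Definition vpos (n : nat) (x : V * bool) (t : R) : Prop := In (Ent (Vt x) t t) (cyc n).
Definition gap (n : nat) x a y b : Prop := gap_in (cyc n) x a y b.

Lemma vpos_le n k x t : (n <= k)%nat -> vpos n x t -> vpos k x t.
Proof.
  induction 1 as [|k L IH]; auto. intros H. specialize (IH H). unfold vpos in *.
  rewrite cyc_S. apply in_flat_map. eexists; split; [exact IH|]. left; auto.
Qed.

Lemma subdivide_last e : proper e -> exists p g, subdivide e = p ++ [g] /\
  final (it g) = final (it e) /\ hi g = hi e.
Proof.
  intros P. destruct (it e) as [z|v s] eqn:E.
  - exists [], e. rewrite (subdivide_Vt _ _ E), E; auto.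
  - assert (N : subdivide e <> []) by (rewrite (subdivide_Bk _ _ _ E); simpl; discriminate).
    destruct (exists_last N) as (p & g & Eq). exists p, g; split; auto.
    pose proof (subdivide_run e (v, negb s) (lo e - 1) P) as H. rewrite Eq, E in H.
    destruct (run_app_inv _ _ p [g] _ _ (H (hadj_sym _ _ (hadj_vertical v s)) ltac:(lra)))
      as (y & b & _ & R1).
    simpl in R1. intuition.
Qed.

Lemma subdivide_head e : exists f q, subdivide e = f :: q /\ first (it f) = first (it e) /\ lo f = lo e.
Proof.
  destruct (it e) as [z|v s] eqn:E.
  - exists e, []. rewrite (subdivide_Vt _ _ E), E; auto.
  - rewrite (subdivide_Bk _ _ _ E). simpl. eexists _, _; split; eauto.
Qed.

(** Subdivision may replace the two entries around a gap, but the last piece of the left one and the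
    first piece of the right one keep the outer vertex and position. *)
Lemma gap_le n k x a y b : (n <= k)%nat -> gap n x a y b -> gap k x a y b.
Proof.
  induction 1 as [|k L IH]; auto. intros H. specialize (IH H). unfold gap in *.
  destruct IH as (l1 & e & e' & l2 & Eq & -> & -> & -> & ->).
  assert (Pe : proper e) by (apply (cyc_proper k); rewrite Eq; apply in_or_app; simpl; auto).
  destruct (subdivide_last e Pe) as (p & g & E1 & E2 & E3).
  destruct (subdivide_head e') as (f & q & F1 & F2 & F3).
  exists (flat_map subdivide l1 ++ p), g, f, (q ++ flat_map subdivide l2).
  rewrite cyc_S, Eq, flat_map_app. simpl. rewrite E1, F1, <- !app_assoc. simpl. auto.
Qed.

Lemma gap_props n x a y b : gap n x a y b -> hadj x y /\ a < b.
Proof. apply (run_gap _ _ _ _ _ _ _ _ _ (cyc_run n)). Qed.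

(** One more level is needed since the entries around the gap may be blocks, whose end vertices
    become entries only on subdivision. *)
Lemma gap_vpos n x a y b : gap n x a y b -> vpos (S n) x a /\ vpos (S n) y b.
Proof.
  intros (l1 & e & e' & l2 & Eq & -> & -> & -> & ->).
  assert (Ie : In e (cyc n)) by (rewrite Eq; apply in_or_app; simpl; auto).
  assert (Ie' : In e' (cyc n)) by (rewrite Eq; apply in_or_app; simpl; auto).
  unfold vpos; rewrite cyc_S. split; apply in_flat_map; [exists e|exists e']; split; auto.
  - pose proof (cyc_proper _ _ Ie) as P. destruct (it e) as [z|v s] eqn:E.
    + rewrite (subdivide_Vt _ _ E). left. unfold proper in P; rewrite E in P.
      destruct e; simpl in *; congruence.
    + apply (subdivide_ends _ _ _ E P).
  - pose proof (cyc_proper _ _ Ie') as P. destruct (it e') as [z|v s] eqn:E.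
    + rewrite (subdivide_Vt _ _ E). left. unfold proper in P; rewrite E in P.
      destruct e'; simpl in *; congruence.
    + apply (subdivide_ends _ _ _ E P).
Qed.

Lemma vpos_bounds n x t : vpos n x t -> -1 <= t <= 3.
Proof. intros H; apply cyc_bounds in H; simpl in H; lra. Qed.

Lemma gap_bounds n x a y b : gap n x a y b -> -1 <= a /\ a < b /\ b <= 3.
Proof.
  intros G. pose proof (gap_props _ _ _ _ _ G) as [_ L].
  apply gap_vpos in G. destruct G as [H1 H2]. apply vpos_bounds in H1, H2. lra.
Qed.

Lemma vpos_fun n m x y t : vpos n x t -> vpos m y t -> x = y.
Proof.
  intros H H'. apply (vpos_le _ (max n m)) in H; [|lia]. apply (vpos_le _ (max n m)) in H'; [|lia].
  pose proof (cyc_unique _ _ _ t H H') as E. simpl in E.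
  injection E; auto; lra.
Qed.

Lemma gap_entry n x a y b e : gap n x a y b -> In e (cyc n) -> hi e <= a \/ b <= lo e.
Proof.
  intros (l1 & f & f' & l2 & Eq & -> & -> & -> & ->) I.
  pose proof (cyc_run n) as R1. rewrite Eq in R1, I.
  destruct (run_app_inv _ _ _ _ _ _ R1) as (z & c & Ra & Rb).
  simpl in Rb. destruct Rb as (_ & B1 & B2 & _ & B3 & B4 & Rc).
  apply in_app_or in I. destruct I as [I|[<-|[<-|I]]].
  - apply (run_in _ _ _ _ _ Ra) in I. lra.
  - lra.
  - lra.
  - apply (run_in _ _ _ _ _ Rc) in I. lra.
Qed.

Lemma gap_no_vertex n m x a y b z t : gap n x a y b -> vpos m z t -> t <= a \/ b <= t.
Proof.
  intros G H. apply (gap_le _ (max n m)) in G; [|lia]. apply (vpos_le _ (max n m)) in H; [|lia].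
  apply (gap_entry _ _ _ _ _ _ G H).
Qed.

(** Gaps are bounded by vertex positions and contain none, so two overlapping gaps coincide,
    whatever their levels. *)
Lemma gap_fun n m x a y b x' a' y' b' t : gap n x a y b -> gap m x' a' y' b' ->
  a < t < b -> a' < t < b' -> x = x' /\ a = a' /\ y = y' /\ b = b'.
Proof.
  intros G G' T T'.
  destruct (gap_vpos _ _ _ _ _ G) as [H1 H2]. destruct (gap_vpos _ _ _ _ _ G') as [H1' H2'].
  pose proof (gap_no_vertex _ _ _ _ _ _ _ _ G H1').
  pose proof (gap_no_vertex _ _ _ _ _ _ _ _ G H2').
  pose proof (gap_no_vertex _ _ _ _ _ _ _ _ G' H1).
  pose proof (gap_no_vertex _ _ _ _ _ _ _ _ G' H2).
  assert (a = a') by lra. assert (b = b') by lra. subst.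
  repeat split; eapply vpos_fun; eauto.
Qed.

Lemma level_start n : In (Ent (Vt (r, false)) (-1) (-1)) (level (S n)) /\
  In (Ent (Vt (r, true)) 1 1) (level (S n)).
Proof.
  induction n as [|n [IH1 IH2]].
  - simpl level. rewrite app_nil_r. apply (subdivide_ends (Ent (Bk r false) (-1) 1) r false eq_refl).
    unfold proper; simpl; lra.
  - split; apply in_flat_map; [exists (Ent (Vt (r, false)) (-1) (-1))|exists (Ent (Vt (r, true)) 1 1)];
      (split; [assumption|left; auto]).
Qed.

Lemma cyc_start n : exists e, In e (cyc n) /\ lo e = -1.
Proof.
  destruct n as [|n].
  - eexists; split; [left; eauto|auto].
  - exists (Ent (Vt (r, false)) (-1) (-1)); split; [|auto].
    apply in_or_app; left; apply level_start.
Qed.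

(** The distance 4 is that of -1 and 3, the two positions of [(r, false)]. *)
Lemma vpos_unique n m x a b : vpos n x a -> vpos m x b -> a = b \/ Rabs (a - b) = 4.
Proof.
  intros H H'. set (k := max n m).
  apply (vpos_le _ (S k)) in H; [|lia]. apply (vpos_le _ (S k)) in H'; [|lia].
  apply cyc_in in H. apply cyc_in in H'.
  assert (St : forall t, In (Ent (Vt (r, false)) t t) (level (S k)) -> t = -1).
  { intros t Ht. pose proof (level_disjoint _ _ _ (r, false) Ht (proj1 (level_start k)) eq_refl eq_refl).
    congruence. }
  destruct H as [H|H], H' as [H'|H'].
  - left. pose proof (level_disjoint _ _ _ x H H' eq_refl eq_refl). congruence.
  - injection H' as -> ->. apply St in H. right. subst. unfold Rabs; destruct (Rcase_abs _); lra.
  - injection H as -> ->. apply St in H'. right. subst. unfold Rabs; destruct (Rcase_abs _); lra.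
  - left; congruence.
Qed.

(** On a level beyond the depth of x, a block is rooted deeper than x and cannot cover it. *)
Lemma vpos_exists x : exists n t, vpos n x t.
Proof.
  set (n := S (length (up (fst x)))). destruct (level_covers n x) as (e & I & C).
  destruct (it e) as [z|v s] eqn:E.
  - exists n, (lo e). simpl in C; subst z. pose proof (level_proper _ _ I) as P.
    unfold proper in P; rewrite E in P. apply in_or_app; left.
    destruct e; simpl in *; congruence.
  - exfalso. destruct (level_block _ _ _ _ I E) as [D _]. simpl in C.
    apply sub_length in C. unfold n in D; lia.
Qed.

Lemma vpos_right n x t : vpos n x t -> t < 3 -> exists y b, gap n x t y b.
Proof.
  intros H T. apply in_split in H. destruct H as (l1 & l2 & E).
  destruct l2 as [|e l2].
  - exfalso. pose proof (cyc_run n) as R1. rewrite E in R1.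
    destruct (run_app_inv _ _ _ _ _ _ R1) as (y & b & _ & R2). simpl in R2.
    destruct R2 as (_ & _ & _ & _ & R2); lra.
  - exists (first (it e)), (lo e), l1, (Ent (Vt x) t t), e, l2. auto.
Qed.

Lemma nil_or_last {A : Type} (l : list A) : l = [] \/ exists l' a, l = l' ++ [a].
Proof.
  destruct l as [|a l]; auto. right.
  destruct (@exists_last _ (a :: l)) as (l' & b & E); [discriminate|eauto].
Qed.

Lemma vpos_left n x t : vpos n x t -> -1 < t -> exists y a, gap n y a x t.
Proof.
  intros H T. apply in_split in H. destruct H as (l1 & l2 & E).
  destruct (nil_or_last l1) as [->|(l & e & ->)].
  - exfalso. pose proof (cyc_run n) as R1. destruct (cyc_start n) as (e & I & L).
    rewrite E in R1, I. simpl in R1, I. destruct R1 as (_ & _ & _ & R2).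
    destruct I as [<-|I]; [simpl in L; lra|]. apply (run_in _ _ _ _ _ R2) in I; lra.
  - exists (final (it e)), (hi e), l, e, (Ent (Vt x) t t), l2. rewrite E, <- app_assoc. auto.
Qed.

(** A parameter that no level assigns to a vertex or an edge stays in some block on every level;
    choice collects the roots of these blocks. *)
Lemma locate t : -1 <= t <= 3 ->
  (exists n x, vpos n x t) \/
  (exists n x a y b, gap n x a y b /\ a < t < b) \/
  (exists c : nat -> V, forall n, exists s a b, In (Ent (Bk (c n) s) a b) (level n) /\ a <= t <= b).
Proof.
  intros T. apply NNPP; intros N. apply N. right; right.
  assert (H : forall n, exists c s a b, In (Ent (Bk c s) a b) (level n) /\ a <= t <= b).
  { intros n. destruct (run_locate _ _ _ _ _ t (cyc_run n)) as [(e & I & H)|[(x & a & y & b & H)|H]];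
      [lra| | |].
    - pose proof (cyc_proper _ _ I) as P. destruct e as [[z|v s] a b]; simpl in *.
      + exfalso; apply N. left; exists n, z. unfold proper in P; simpl in P.
        replace t with a by lra. subst b; exact I.
      + apply cyc_in in I. destruct I as [I|I]; [|discriminate]. eauto 10.
    - exfalso; apply N. right; left. exists n, x, a, y, b; auto.
    - exfalso. destruct (cyc_start n) as (e & I & L). apply H in I; lra. }
  apply pointwise_choice in H. exact H.
Qed.

Definition blk (n : nat) (v : V) (a b : R) : Prop := exists s, In (Ent (Bk v s) a b) (level n).

Lemma blk_props n v a b : blk n v a b ->
  -1 <= a /\ a < b /\ b <= 1 /\ (n <= length (up v))%nat /\ b - a <= 2 / 2 ^ n.
Proof.
  intros [s H]. destruct (level_block _ _ _ _ H eq_refl) as [H1 H2].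
  pose proof (level_bounds _ _ H) as B. pose proof (level_proper _ _ H) as P.
  unfold proper in P; simpl in *. repeat split; auto; lra.
Qed.

Lemma blk_ends n v a b : blk n v a b -> (exists x, vpos (S n) x a) /\ (exists x, vpos (S n) x b).
Proof.
  intros [s H]. destruct (subdivide_ends (Ent (Bk v s) a b) v s eq_refl (level_proper _ _ H)) as [H1 H2].
  simpl in *. split; [exists (v, s)|exists (v, negb s)]; apply in_or_app; left;
    apply in_flat_map; exists (Ent (Bk v s) a b); auto.
Qed.

Lemma blk_vpos n v a b m x t : blk n v a b -> vpos m x t -> a <= t <= b -> sub v (fst x).
Proof.
  intros B H T. pose proof (blk_props _ _ _ _ B) as (_ & _ & L & _). destruct B as [s B].
  apply (vpos_le _ (max n m)) in H; [|lia]. apply cyc_in in H.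
  destruct H as [H|H]; [|injection H as _ ->; lra].
  destruct (level_ancestor n _ _ (Nat.le_max_l n m) H) as (d & D & L1 & L2 & C). simpl in *.
  assert (E : d = Ent (Bk v s) a b).
  { apply (cyc_unique n d _ t); simpl; try lra; apply in_or_app; auto. }
  subst d. apply (C x); auto.
Qed.

(** The root is excluded because [(r, false)] also sits at 3, outside every block. *)
Lemma vpos_blk n v a b m x t : blk n v a b -> v <> r -> vpos m x t -> sub v (fst x) -> a <= t <= b.
Proof.
  intros [s B] Nr H S. apply (vpos_le _ (max n m)) in H; [|lia]. apply cyc_in in H.
  destruct H as [H|H].
  - destruct (level_ancestor n _ _ (Nat.le_max_l n m) H) as (d & D & L1 & L2 & C). simpl in *.
    assert (E : d = Ent (Bk v s) a b).
    { apply (level_disjoint n d _ x); auto. }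
    subst d; simpl in *; lra.
  - injection H as -> _. simpl in S. exfalso; apply Nr. apply sub_antisym; auto. apply sub_root.
Qed.

Lemma blk_nested n k v w a b a' b' t : (n <= k)%nat -> blk n v a b -> blk k w a' b' ->
  a <= t <= b -> a' <= t <= b' -> sub v w /\ a <= a' /\ b' <= b.
Proof.
  intros L [s B] [s' B'] T T'.
  destruct (level_ancestor n _ _ L B') as (d & D & L1 & L2 & C). simpl in *.
  assert (E : d = Ent (Bk v s) a b).
  { apply (cyc_unique n d _ t); simpl; try lra; apply in_or_app; auto. }
  subst d; simpl in *. repeat split; auto. apply (C (w, false)); simpl; apply sub_refl.
Qed.

Lemma blk_same n v w a b a' b' x : blk n v a b -> blk n w a' b' -> sub v x -> sub w x ->
  v = w /\ a = a' /\ b = b'.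
Proof.
  intros [s B] [s' B'] S S'.
  pose proof (level_disjoint _ _ _ (x, false) B B' S S'). repeat split; congruence.
Qed.

(** The inclusion is strict because on the next level both end positions are taken by the two copies
    of v. *)
Lemma blk_step n v w a b a' b' t : blk n v a b -> blk (S n) w a' b' ->
  a <= t <= b -> a' <= t <= b' ->
  a < a' /\ b' < b /\ (child v w \/ exists u, child v u /\ child u w).
Proof.
  intros B B' T T'. destruct (blk_nested n (S n) _ _ _ _ _ _ t ltac:(lia) B B' T T') as (_ & L1 & L2).
  destruct (blk_ends _ _ _ _ B) as [[x Hx] [y Hy]].
  pose proof (blk_props _ _ _ _ B') as (_ & L & _). destruct B' as [s' B'].
  assert (I : In (Ent (Bk w s') a' b') (cyc (S n))) by (apply in_or_app; auto).
  repeat split.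
  - destruct L1 as [L1| ->]; auto. exfalso.
    pose proof (cyc_unique _ _ _ a' I Hx) as E. simpl in E. discriminate E; lra.
  - destruct L2 as [L2| ->]; auto. exfalso.
    pose proof (cyc_unique _ _ _ b I Hy) as E. simpl in E. discriminate E; lra.
  - simpl in B'. apply in_flat_map in B'. destruct B' as (d & D & B').
    destruct B as [s B]. pose proof (level_proper _ _ D) as P.
    pose proof (subdivide_in _ _ P B') as (L3 & L4 & _). simpl in *.
    assert (E : d = Ent (Bk v s) a b).
    { apply (cyc_unique n d _ t); simpl; try lra; apply in_or_app; auto. }
    subst d. eapply subdivide_block; eauto; reflexivity.
Qed.

(** * Points and ends on the curve *)

Hypothesis up_normal : forall x y, adj x y -> In x (y :: up y) \/ In y (x :: up x).

Local Notation X := (V * bool)%type.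
Local Notation same_comp := (same_comp X hadj).
Local Notation tail_in_comp := (tail_in_comp X hadj).
Local Notation basic_nbhd := (basic_nbhd X hadj).

Definition chain (t : R) (c : nat -> V) : Prop :=
  forall n, exists a b, blk n (c n) a b /\ a <= t <= b.

Definition base (c : nat -> V) : nat -> X := fun n => (c n, false).

Definition limit_end (c : nat -> V) : (nat -> X) -> Prop :=
  fun q => ray X hadj q /\ equiv_rays X hadj (base c) q.

(** Kept as a relation, so that a vertex or gap may be witnessed on any level; uniqueness is
    supplied by [located_at_vertex] and [located_at_gap]. *)
Inductive located (t : R) : point X -> Prop :=
| located_vertex n x : vpos n x t -> located t (Pt X (vertex_point X x))
| located_edge n x a y b : gap n x a y b -> a < t < b ->
    located t (Pt X (edge_point X x y ((t - a) / (b - a))))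
| located_end c : chain t c -> located t (End X (limit_end c)).

Lemma located_exists t : -1 <= t <= 3 -> exists q, located t q.
Proof.
  intros T. destruct (locate t T) as [(n & x & H)|[(n & x & a & y & b & G & H)|(c & H)]].
  - eexists; eapply located_vertex; eauto.
  - eexists; eapply located_edge; eauto.
  - exists (End X (limit_end c)). apply located_end. intros n.
    destruct (H n) as (s & a & b & I & L). exists a, b; split; auto. exists s; auto.
Qed.

Lemma chain_no_vertex t c n x : chain t c -> ~ vpos n x t.
Proof.
  intros C H. destruct (C n) as (a & b & [s B] & T).
  assert (I : In (Ent (Bk (c n) s) a b) (cyc n)) by (apply in_or_app; auto).
  pose proof (cyc_unique _ _ _ t H I) as E. simpl in E. discriminate E; lra.
Qed.

Lemma chain_no_gap t c n x a y b : chain t c -> gap n x a y b -> ~ a < t < b.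
Proof.
  intros C G T. destruct (C n) as (a' & b' & [s B] & T').
  assert (I : In (Ent (Bk (c n) s) a' b') (cyc n)) by (apply in_or_app; auto).
  pose proof (gap_entry _ _ _ _ _ _ G I) as E. simpl in E. lra.
Qed.

Lemma located_at_vertex n x t q : vpos n x t -> located t q -> q = Pt X (vertex_point X x).
Proof.
  intros H L. destruct L as [m y H'|m y a z b G T|c C].
  - rewrite (vpos_fun _ _ _ _ _ H H'); auto.
  - pose proof (gap_no_vertex _ _ _ _ _ _ _ _ G H). lra.
  - destruct (chain_no_vertex _ _ _ _ C H).
Qed.

Lemma located_at_gap n x a y b t q : gap n x a y b -> a < t < b -> located t q ->
  q = Pt X (edge_point X x y ((t - a) / (b - a))).
Proof.
  intros G T L. destruct L as [m z H|m x' a' y' b' G' T'|c C].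
  - pose proof (gap_no_vertex _ _ _ _ _ _ _ _ G H). lra.
  - destruct (gap_fun _ _ _ _ _ _ _ _ _ _ _ G G' T T') as (-> & -> & -> & ->); auto.
  - destruct (chain_no_gap _ _ _ _ _ _ _ C G T).
Qed.

Lemma fraction a t b : a < t < b -> 0 < (t - a) / (b - a) < 1.
Proof.
  intros T. split; [apply Rdiv_lt_0_compat; lra|].
  apply (Rmult_lt_reg_r (b - a)); [lra|]. unfold Rdiv.
  rewrite Rmult_assoc, Rinv_l; lra.
Qed.

Lemma fraction_mul a t b : a < b -> (t - a) / (b - a) * (b - a) = t - a.
Proof. intros; field; lra. Qed.

Lemma chain_sub t c n k : chain t c -> (n <= k)%nat -> sub (c n) (c k).
Proof.
  intros C L. destruct (C n) as (a & b & B & T), (C k) as (a' & b' & B' & T').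
  eapply blk_nested; eauto.
Qed.

Lemma chain_step t c n : chain t c ->
  child (c n) (c (S n)) \/ exists u, child (c n) u /\ child u (c (S n)).
Proof.
  intros C. destruct (C n) as (a & b & B & T), (C (S n)) as (a' & b' & B' & T').
  eapply blk_step; [exact B|exact B'|exact T|exact T'].
Qed.

(** Passing to a child or grandchild is an edge of the square, and the strictly growing depth gives
    injectivity. *)
Lemma chain_ray t c : chain t c -> ray X hadj (base c).
Proof.
  intros C. assert (S1 : forall n, (length (up (c n)) < length (up (c (S n))))%nat).
  { intros n. unfold child in *. destruct (chain_step t c n C) as [H|(u & H1 & H2)];
      unfold child in *.
    - rewrite H; simpl; lia.
    - rewrite H2; simpl; rewrite H1; simpl; lia. }
  assert (S2 : forall n m, (n < m)%nat -> (length (up (c n)) < length (up (c m)))%nat).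
  { induction 1 as [|m L IH]; auto. specialize (S1 m); lia. }
  split.
  - intros m n E. injection E as E. destruct (lt_eq_lt_dec m n) as [[L|]|L]; auto;
      apply S2 in L; rewrite E in L; lia.
  - intros n. destruct (chain_step t c n C) as [H|(u & H1 & H2)].
    + apply hadj_child; auto.
    + eapply hadj_grandchild; eauto.
Qed.

Lemma limit_end_is_end t c : chain t c -> is_end X hadj (limit_end c).
Proof. intros C. exists (base c). split; [eapply chain_ray; eauto|]. intros q; reflexivity. Qed.

Lemma limit_end_base t c : chain t c -> limit_end c (base c).
Proof. intros C. pose proof (chain_ray t c C). split; auto. apply equiv_rays_refl; auto using hadj_sym. Qed.

(** Each vertex is linked to v through its parents on its own level, and the vertical edge at v
    joins the two levels. *)
Lemma subtree_connected v S : (forall x, sub v (fst x) -> ~ In x S) ->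
  forall x y, sub v (fst x) -> sub v (fst y) -> same_comp S x y.
Proof.
  intros A.
  enough (H : forall w, sub v w -> forall s, same_comp S (v, false) (w, s)).
  { intros [x s] [y s'] Hx Hy. eapply same_comp_trans; [apply same_comp_sym|]; auto using hadj_sym. }
  assert (H0 : forall s, same_comp S (v, false) (v, s)).
  { intros [|].
    - apply same_comp_adj; [apply (hadj_vertical v false)| |]; apply A, sub_refl.
    - apply same_comp_refl, A, sub_refl. }
  intros w; pattern w; apply up_ind; clear w.
  - intros [<-|H]; auto. rewrite up_root in H; destruct H.
  - intros p w Hw _ IH H s. pose proof H as H'. apply (sub_step p _ _ Hw) in H'.
    destruct H' as [->|H']; auto. eapply same_comp_trans; [apply IH; auto|].
    apply same_comp_adj; [apply hadj_child, Hw| |]; apply A; auto.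
Qed.

(* The ancestors of v and their neighbours do it: after deleting them, an edge of the
   square cannot leave the subtree at v. *)
Lemma separator v : exists S : list X,
  forall x y, same_comp S x y -> sub v (fst x) -> sub v (fst y).
Proof.
  destruct (pointwise_choice _ adj_lf) as [nb Hnb].
  set (A := up v ++ flat_map nb (up v)).
  set (S := flat_map (fun u => [(u, true); (u, false)]) A).
  assert (HS : forall x : X, In (fst x) A -> In x S).
  { intros [u s] H. apply in_flat_map. exists u; split; auto. destruct s; simpl; auto. }
  (* Normality: an edge leaving the subtree ends at a proper ancestor of v. On a path of length two
     that leaves it, either the outer end or the middle vertex is such an ancestor. *)
  assert (Nv : forall x y, adj x y -> sub v x -> ~ sub v y -> In y (up v)).
  { intros x y Hxy Sx Ny. destruct (up_normal x y Hxy) as [H|H].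
    - destruct Ny. eapply sub_trans; eauto.
    - destruct (sub_total v y x) as [H'|[->|H']]; auto; try tauto.
      destruct Ny; apply sub_refl. }
  exists S. intros x y (_ & _ & P). induction P as [x y (Hxy & Nx & Ny)|x|x y z]; auto.
  intros Sx. apply NNPP; intros N. apply Ny, HS.
  destruct Hxy as [(_ & _ & [H|(w & H1 & H2)])|[E _]].
  - apply in_or_app; left. eapply Nv; eauto.
  - apply in_or_app. destruct (classic (sub v w)) as [Sw|Nw].
    + left. eapply Nv; eauto.
    + right. apply in_flat_map. exists w. split; [eapply Nv; eauto|auto].
  - rewrite E in Sx; tauto.
Qed.

(** All vertices below [c n] have depth at least n, which eventually exceeds every depth occurring
    in S. *)
Lemma chain_avoids t c (S : list X) : chain t c ->
  exists n, forall x, sub (c n) (fst x) -> ~ In x S.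
Proof.
  intros C.
  assert (H : exists n, forall x, In x S -> (length (up (fst x)) < n)%nat).
  { induction S as [|s S [n IH]]; [exists 0%nat; intros x []|].
    exists (max n (1 + length (up (fst s)))). intros x [<-|I]; [lia|]. apply IH in I; lia. }
  destruct H as [n H]. exists n. intros x Hx I. apply H in I. apply sub_length in Hx.
  destruct (C n) as (a & b & B & _). apply blk_props in B. lia.
Qed.

Lemma chain_in_C t c S n : chain t c -> (forall x, sub (c n) (fst x) -> ~ In x S) ->
  forall x, sub (c n) (fst x) -> in_C X hadj S (limit_end c) x.
Proof.
  intros C A x Hx. exists (base c). split; [eapply limit_end_base; eauto|].
  exists n. intros m L. eapply subtree_connected; eauto. eapply chain_sub; eauto.
Qed.

(* Closeness of parameters modulo 4, as the ends of [-1, 3] are identified. *)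
Definition near (d t t' : R) : Prop := Rabs (t - t') < d \/ 4 - d < Rabs (t - t').

(** The two sides of a vertex are treated alike, also for [(r, false)]: there the gap before it ends
    at tl = 3 and the gap after it starts at tr = -1, while otherwise tl = tr = t. *)
Lemma vertex_gaps n x t : vpos n x t -> exists m y a tl tr z b,
  vpos m x tl /\ vpos m x tr /\ gap m y a x tl /\ gap m x tr z b /\
  forall d t', -1 <= t' <= 3 -> d <= tl - a -> d <= b - tr -> near d t t' ->
    tl - d < t' <= tl \/ tr <= t' < tr + d.
Proof.
  (* On level 0 the position -1 still belongs to a block; from level 1 on it holds [(r, false)]. *)
  intros H. apply (vpos_le _ (S n)) in H; [|lia].
  pose proof (vpos_bounds _ _ _ H) as T.
  assert (H3 : vpos (S n) (r, false) 3) by (apply in_or_app; right; left; auto).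
  assert (H1 : vpos (S n) (r, false) (-1)) by (apply in_or_app; left; apply level_start).
  destruct (vpos_left _ _ _ H3) as (y & a & G3); [lra|].
  destruct (vpos_right _ _ _ H1) as (z & b & G1); [lra|].
  exists (S n).
  destruct (Req_dec t (-1)) as [->|N1]; [|destruct (Req_dec t 3) as [->|N3]].
  - rewrite (vpos_fun _ _ _ _ _ H H1). exists y, a, 3, (-1), z, b.
    repeat split; auto. intros d t' T' _ _ [L|L]; unfold Rabs in L; destruct (Rcase_abs _); lra.
  - rewrite (vpos_fun _ _ _ _ _ H H3). exists y, a, 3, (-1), z, b.
    repeat split; auto. intros d t' T' _ _ [L|L]; unfold Rabs in L; destruct (Rcase_abs _); lra.
  - clear y a z b G1 G3.
    destruct (vpos_left _ _ _ H) as (y & a & Gl); [lra|].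
    destruct (vpos_right _ _ _ H) as (z & b & Gr); [lra|].
    pose proof (gap_bounds _ _ _ _ _ Gl). pose proof (gap_bounds _ _ _ _ _ Gr).
    exists y, a, t, t, z, b. repeat split; auto.
    intros d t' T' D1 D2 [L|L]; unfold Rabs in L; destruct (Rcase_abs _); lra.
Qed.

(** * Continuity of the curve *)

Lemma vertex_point_not_edge x u v : ~ is_edge_pt X hadj u v (vertex_point X x).
Proof. intros E. eapply vertex_edge_excl; [|exact E]. apply vertex_point_vertex. Qed.

Lemma edge_point_not_vertex x y t v : hadj x y -> 0 < t < 1 -> ~ is_vertex_pt X v (edge_point X x y t).
Proof.
  intros A T H. eapply vertex_edge_excl; [exact H|].
  apply (edge_point_edge X hadj hadj_irrefl); eauto.
Qed.

Lemma located_continuous_vertex n x t N : vpos n x t -> basic_nbhd (Pt X (vertex_point X x)) N ->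
  exists d, 0 < d /\ forall t' q', -1 <= t' <= 3 -> near d t t' -> located t' q' -> N q'.
Proof.
  intros H [(v & eps & Hv & E & HN)|(u & v & eps & Hv & _)]; [|destruct (vertex_point_not_edge _ _ _ Hv)].
  apply vertex_point_inv in Hv; subst v.
  destruct (vertex_gaps n x t H) as (m & y & a & tl & tr & z & b & Hl & Hr & Gl & Gr & Near).
  destruct (gap_props _ _ _ _ _ Gl) as [Al Ll]. destruct (gap_props _ _ _ _ _ Gr) as [Ar Lr].
  (* The coordinate at x falls linearly from 1 to 0 along a gap, so it exceeds 1 - eps within eps
     times the gap length. *)
  set (d := Rmin (eps * (tl - a)) (eps * (b - tr))).
  assert (D1 : d <= eps * (tl - a)) by apply Rmin_l.
  assert (D2 : d <= eps * (b - tr)) by apply Rmin_r.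
  assert (D : 0 < d) by (apply Rmin_glb_lt; apply Rmult_lt_0_compat; lra).
  clearbody d. exists d. split; auto. intros t' q' T' Nt L'. apply HN.
  destruct (Near d t' T') as [T|T]; auto; try nra.
  - destruct (Req_dec t' tl) as [->|Ne].
    { rewrite (located_at_vertex _ _ _ _ Hl L'). eexists; split; eauto.
      left; apply vertex_point_vertex. }
    assert (T2 : a < t' < tl) by nra.
    rewrite (located_at_gap _ _ _ _ _ _ _ Gl T2 L'). eexists; split; eauto. right.
    exists y. split.
    + apply edge_pt_flip; [apply hadj_sym|]. apply (edge_point_edge X hadj hadj_irrefl); auto.
      apply fraction; auto.
    + rewrite (edge_point_right X); [|apply hadj_irrefl; auto].
      pose proof (fraction_mul a t' tl ltac:(lra)). nra.
  - destruct (Req_dec t' tr) as [->|Ne].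
    { rewrite (located_at_vertex _ _ _ _ Hr L'). eexists; split; eauto.
      left; apply vertex_point_vertex. }
    assert (T2 : tr < t' < b) by nra.
    rewrite (located_at_gap _ _ _ _ _ _ _ Gr T2 L'). eexists; split; eauto. right.
    exists z. split.
    + apply (edge_point_edge X hadj hadj_irrefl); auto. apply fraction; auto.
    + rewrite edge_point_left. pose proof (fraction_mul tr t' b ltac:(lra)). nra.
Qed.

Lemma located_continuous_edge n x a y b t N : gap n x a y b -> a < t < b ->
  basic_nbhd (Pt X (edge_point X x y ((t - a) / (b - a)))) N ->
  exists d, 0 < d /\ forall t' q', -1 <= t' <= 3 -> near d t t' -> located t' q' -> N q'.
Proof.
  intros G T B. destruct (gap_props _ _ _ _ _ G) as [A L].
  pose proof (gap_bounds _ _ _ _ _ G) as Gb.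
  pose proof (fraction _ _ _ T) as F.
  destruct B as [(v & eps & Hv & _)|(u & v & eps & Hv & E & HN)].
  { destruct (edge_point_not_vertex _ _ _ _ A F Hv). }
  (* The first two bounds keep t' inside the gap and exclude the wrap-around case of [near]; the
     third converts parameters into coordinates. *)
  set (d := Rmin (Rmin (t - a) (b - t)) (eps * (b - a))).
  assert (D1 : d <= t - a) by (eapply Rle_trans; [apply Rmin_l|apply Rmin_l]).
  assert (D2 : d <= b - t) by (eapply Rle_trans; [apply Rmin_l|apply Rmin_r]).
  assert (D3 : d <= eps * (b - a)) by apply Rmin_r.
  assert (D : 0 < d).
  { apply Rmin_glb_lt; [apply Rmin_glb_lt; lra|apply Rmult_lt_0_compat; lra]. }
  clearbody d. exists d. split; auto. intros t' q' T' Nt L'. apply HN.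
  assert (Dt : Rabs (t - t') < d).
  { destruct Nt as [Nt|Nt]; auto. unfold Rabs in *; destruct (Rcase_abs _); lra. }
  apply Rabs_def2 in Dt.
  assert (T2 : a < t' < b) by lra.
  rewrite (located_at_gap _ _ _ _ _ _ _ G T2 L'). eexists; split; eauto.
  pose proof (fraction _ _ _ T2) as F'.
  pose proof (edge_point_edge X hadj hadj_irrefl _ _ _ A F') as E'.
  pose proof (fraction_mul a t' b ltac:(lra)) as M'. pose proof (fraction_mul a t b ltac:(lra)) as M.
  set (l := (t - a) / (b - a)) in *. set (l' := (t' - a) / (b - a)) in *.
  destruct (edge_point_inv X hadj hadj_irrefl _ _ _ _ _ (hadj_irrefl _ _ A) F Hv) as [[-> ->]|[-> ->]].
  - split; auto. rewrite !edge_point_left. apply Rabs_def1; nra.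
  - split; [apply edge_pt_flip; auto; apply hadj_sym|].
    rewrite !(edge_point_right X) by (apply hadj_irrefl; auto). apply Rabs_def1; nra.
Qed.

Lemma located_continuous_end c t N : chain t c -> basic_nbhd (End X (limit_end c)) N ->
  exists d, 0 < d /\ forall t' q', -1 <= t' <= 3 -> near d t t' -> located t' q' -> N q'.
Proof.
  intros C [S HN]. destruct (chain_avoids t c S C) as [n Av].
  pose proof (chain_in_C t c S n C Av) as InC.
  destruct (C n) as (a & b & B & T). pose proof (blk_props _ _ _ _ B) as P.
  destruct (blk_ends _ _ _ _ B) as [[xa Ha] [xb Hb]].
  (* The ends of the block's interval hold vertices, so t is an interior point and the whole
     interval is a neighbourhood of it. *)
  assert (Na : a <> t) by (intros ->; eapply chain_no_vertex; eauto).
  assert (Nb : b <> t) by (intros ->; eapply chain_no_vertex; eauto).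
  exists (Rmin (t - a) (b - t)). split; [apply Rmin_glb_lt; lra|].
  pose proof (Rmin_l (t - a) (b - t)) as D1. pose proof (Rmin_r (t - a) (b - t)) as D2.
  intros t' q' T' Nt L'. apply HN.
  assert (T2 : a < t' < b) by (destruct Nt as [L|L]; unfold Rabs in L; destruct (Rcase_abs _); lra).
  destruct L' as [m x H|m x a' y b' G T3|c' C'].
  - left. exists x. split; [apply vertex_point_vertex|]. apply InC. eapply blk_vpos; eauto; lra.
  - right. pose proof (gap_no_vertex _ _ _ _ _ _ _ _ G Ha). pose proof (gap_no_vertex _ _ _ _ _ _ _ _ G Hb).
    destruct (gap_vpos _ _ _ _ _ G) as [Hx Hy]. destruct (gap_props _ _ _ _ _ G) as [A _].
    exists x, y. split; [apply (edge_point_edge X hadj hadj_irrefl); auto; apply fraction; auto|].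
    split; [left|]; apply InC; [apply (blk_vpos _ _ _ _ _ _ _ B Hx)|apply (blk_vpos _ _ _ _ _ _ _ B Hy)]; lra.
  - split; [eapply limit_end_is_end; eauto|]. exists (base c'). split; [eapply limit_end_base; eauto|].
    exists n. intros k Lk. apply InC. simpl.
    destruct (C' k) as (a' & b' & B' & T4). eapply (blk_nested n k _ _ _ _ _ _ t' Lk B B'); lra.
Qed.

Lemma located_continuous t q N : located t q -> basic_nbhd q N ->
  exists d, 0 < d /\ forall t' q', -1 <= t' <= 3 -> near d t t' -> located t' q' -> N q'.
Proof.
  intros [n x H|n x a y b G T|c C].
  - eapply located_continuous_vertex; eauto.
  - eapply located_continuous_edge; eauto.
  - eapply located_continuous_end; eauto.
Qed.

(** * Continuity of the inverse *)

Lemma vpos_near n m x t t' s d : vpos n x t -> vpos m x s -> Rabs (s - t') < d ->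
  -1 <= t' <= 3 -> near d t t'.
Proof.
  intros H H' D T. pose proof (vpos_bounds _ _ _ H). pose proof (vpos_bounds _ _ _ H').
  destruct (vpos_unique _ _ _ _ _ H H') as [->|U]; [left; auto|right].
  unfold Rabs in *. destruct (Rcase_abs (t - s)), (Rcase_abs (s - t')), (Rcase_abs (t - t')); lra.
Qed.

Lemma located_inverse_vertex n x t d : 0 < d -> vpos n x t ->
  exists N, basic_nbhd (Pt X (vertex_point X x)) N /\
    forall t' q', -1 <= t' <= 3 -> located t' q' -> N q' -> near d t t'.
Proof.
  (* A gap has length at most 4, so a coordinate error below d / 4 is a parameter error below d. *)
  intros D H. set (eps := Rmin 1 (d / 4)).
  assert (E1 : eps <= 1) by apply Rmin_l. assert (E2 : eps <= d / 4) by apply Rmin_r.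
  assert (E : 0 < eps) by (apply Rmin_glb_lt; lra). clearbody eps.
  exists (fun y => exists g, y = Pt X g /\ (is_vertex_pt X x g \/
            exists w, is_edge_pt X hadj x w g /\ g x > 1 - eps)).
  split.
  { left. exists x, eps. split; [apply vertex_point_vertex|]. split; [lra|]. reflexivity. }
  intros t' q' T' L (g & -> & Q). inversion L as [m y H' Eq|m x' a y b G T Eq|]; subst g.
  - destruct Q as [Q|(w & Q & _)]; [|destruct (vertex_point_not_edge _ _ _ Q)].
    apply vertex_point_inv in Q; subst y. eapply vpos_near; eauto. rewrite Rminus_diag, Rabs_R0; auto.
  - destruct (gap_props _ _ _ _ _ G) as [A _]. pose proof (fraction _ _ _ T) as F.
    pose proof (gap_bounds _ _ _ _ _ G) as B. pose proof (fraction_mul a t' b ltac:(lra)) as M.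
    destruct (gap_vpos _ _ _ _ _ G) as [Ha Hb].
    destruct Q as [Q|(w & Q & W)]; [destruct (edge_point_not_vertex _ _ _ _ A F Q)|].
    set (l := (t' - a) / (b - a)) in *.
    destruct (edge_point_inv X hadj hadj_irrefl _ _ _ _ _ (hadj_irrefl _ _ A) F Q) as [[-> ->]|[-> ->]].
    + rewrite edge_point_left in W. apply (vpos_near _ _ _ _ _ _ _ H Ha); auto. apply Rabs_def1; nra.
    + rewrite (edge_point_right X) in W by (apply hadj_irrefl; auto).
      apply (vpos_near _ _ _ _ _ _ _ H Hb); auto. apply Rabs_def1; nra.
Qed.

Variable v0 : V.
Hypothesis v0_root : v0 <> r.

(** If r were the only vertex, its vertical edge would be run through in both directions. Since
    [(r, true)] sits at 1, the gaps could only meet there; but -1, 1 and 3 are all held by copies of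
    r, so [(v0, false)] lies inside one of the gaps. *)
Lemma gaps_not_complementary n m x y b x' y' : gap n x (-1) y b -> ~ gap m x' b y' 3.
Proof.
  intros G G'.
  assert (Hs : vpos 1 (r, false) (-1)) by (apply in_or_app; left; apply level_start).
  assert (H1 : vpos 1 (r, true) 1) by (apply in_or_app; left; apply level_start).
  assert (H3 : vpos 1 (r, false) 3) by (apply in_or_app; right; left; auto).
  pose proof (gap_no_vertex _ _ _ _ _ _ _ _ G H1). pose proof (gap_no_vertex _ _ _ _ _ _ _ _ G' H1).
  pose proof (gap_bounds _ _ _ _ _ G). pose proof (gap_bounds _ _ _ _ _ G').
  assert (b = 1) by lra. subst b.
  destruct (vpos_exists (v0, false)) as (k & p & Hp). pose proof (vpos_bounds _ _ _ Hp).
  pose proof (gap_no_vertex _ _ _ _ _ _ _ _ G Hp). pose proof (gap_no_vertex _ _ _ _ _ _ _ _ G' Hp).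
  assert (P : p = -1 \/ p = 1 \/ p = 3) by lra.
  destruct P as [->|[->| ->]];
    [pose proof (vpos_fun _ _ _ _ _ Hp Hs)|pose proof (vpos_fun _ _ _ _ _ Hp H1)
    |pose proof (vpos_fun _ _ _ _ _ Hp H3)]; congruence.
Qed.

Lemma gap_not_full n x y : ~ gap n x (-1) y 3.
Proof.
  intros G.
  assert (H1 : vpos 1 (r, true) 1) by (apply in_or_app; left; apply level_start).
  pose proof (gap_no_vertex _ _ _ _ _ _ _ _ G H1). lra.
Qed.

Lemma located_inverse_edge n x a y b t d : 0 < d -> gap n x a y b -> a < t < b ->
  exists N, basic_nbhd (Pt X (edge_point X x y ((t - a) / (b - a)))) N /\
    forall t' q', -1 <= t' <= 3 -> located t' q' -> N q' -> near d t t'.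
Proof.
  intros D G T. destruct (gap_props _ _ _ _ _ G) as [A L].
  pose proof (fraction _ _ _ T) as F. pose proof (fraction_mul a t b L) as M.
  set (l := (t - a) / (b - a)) in *.
  exists (fun z => exists g, z = Pt X g /\ is_edge_pt X hadj x y g /\
            Rabs (g x - edge_point X x y l x) < d / 4).
  split.
  { right. exists x, y, (d / 4). split; [apply (edge_point_edge X hadj hadj_irrefl); auto|].
    split; [lra|]. reflexivity. }
  intros t' q' T' L' (g & -> & Q & W). inversion L' as [m z H' Eq|m x' a' y' b' G' T2 Eq|]; subst g.
  { destruct (vertex_point_not_edge _ _ _ Q). }
  destruct (gap_props _ _ _ _ _ G') as [A' L2]. pose proof (fraction _ _ _ T2) as F'.
  pose proof (fraction_mul a' t' b' L2) as M'. set (l' := (t' - a') / (b' - a')) in *.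
  pose proof (gap_bounds _ _ _ _ _ G) as B. pose proof (gap_bounds _ _ _ _ _ G') as B'.
  destruct (gap_vpos _ _ _ _ _ G) as [Ha Hb]. destruct (gap_vpos _ _ _ _ _ G') as [Ha' Hb'].
  destruct (edge_point_inv X hadj hadj_irrefl _ _ _ _ _ (hadj_irrefl _ _ A') F' Q) as [[-> ->]|[-> ->]].
  (* Same direction: a shift by 4 would make a gap start at 3 or end at -1. *)
  - left. rewrite !edge_point_left in W.
    assert (a = a').
    { destruct (vpos_unique _ _ _ _ _ Ha Ha') as [|U]; auto.
      unfold Rabs in U; destruct (Rcase_abs _); lra. }
    assert (b = b').
    { destruct (vpos_unique _ _ _ _ _ Hb Hb') as [|U]; auto.
      unfold Rabs in U; destruct (Rcase_abs _); lra. }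
    subst a' b'. apply Rabs_def2 in W. apply Rabs_def1; nra.
  (* Opposite direction: a and b' hold one vertex, b and a' the other. Without a shift by 4 the
     orientations clash, with one shift the gaps are complementary, with two a gap fills the
     interval. *)
  - exfalso. destruct (vpos_unique _ _ _ _ _ Ha Hb') as [U|U], (vpos_unique _ _ _ _ _ Hb Ha') as [U'|U'].
    + lra.
    + assert (b = 3 /\ a' = -1) as [-> ->] by (unfold Rabs in U'; destruct (Rcase_abs _); lra).
      subst b'. apply (gaps_not_complementary _ _ _ _ _ _ _ G' G).
    + assert (a = -1 /\ b' = 3) as [-> ->] by (unfold Rabs in U; destruct (Rcase_abs _); lra).
      subst a'. apply (gaps_not_complementary _ _ _ _ _ _ _ G G').
    + assert (a = -1 /\ b = 3) as [-> ->].
      { unfold Rabs in U, U'; destruct (Rcase_abs _), (Rcase_abs _); lra. }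
      apply (gap_not_full _ _ _ G).
Qed.

Lemma pow2_small d : 0 < d -> exists n, 2 / 2 ^ n < d.
Proof.
  intros D. destruct (pow_lt_1_zero (/ 2) ltac:(rewrite Rabs_right; lra) (d / 2) ltac:(lra)) as [n H].
  exists n. specialize (H n (le_n _)). rewrite pow_inv in H.
  apply Rabs_def2 in H. unfold Rdiv in *. lra.
Qed.

Lemma located_inverse_end c t d : 0 < d -> chain t c ->
  exists N, basic_nbhd (End X (limit_end c)) N /\
    forall t' q', -1 <= t' <= 3 -> located t' q' -> N q' -> near d t t'.
Proof.
  intros D C. destruct (pow2_small d D) as [n Hn].
  (* Two levels are used: the inner block is separated from the rest, and a gap that starts or ends
     in its interval may stick out of it, but not beyond a or b, which hold vertices. *)
  destruct (C n) as (a & b & B & T), (C (S n)) as (a' & b' & B' & T').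
  destruct (blk_step _ _ _ _ _ _ _ _ B B' T T') as (La & Lb & _).
  pose proof (blk_props _ _ _ _ B) as P. pose proof (blk_props _ _ _ _ B') as P'.
  destruct (blk_ends _ _ _ _ B) as [[xa Ha] [xb Hb]].
  set (v := c (S n)) in *.
  assert (Nr : v <> r) by (intros E; rewrite E, up_root in P'; simpl in P'; lia).
  destruct (separator v) as [S0 Sep].
  pose proof (limit_end_is_end t c C) as IE.
  assert (Inv : forall x, in_C X hadj S0 (limit_end c) x -> sub v (fst x)).
  { intros x Hx. apply (in_C_tail X hadj hadj_sym S0 _ (base c)) in Hx; auto;
      [|eapply limit_end_base; eauto].
    destruct Hx as [k Hk]. specialize (Hk (max k (S n)) ltac:(lia)).
    apply (Sep _ _ (same_comp_sym X hadj hadj_sym _ _ _ Hk)). simpl.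
    eapply chain_sub; eauto; lia. }
  exists (fun y => match y with
    | Pt _ g => (exists w, is_vertex_pt X w g /\ in_C X hadj S0 (limit_end c) w) \/
        (exists u w, is_edge_pt X hadj u w g /\
           (in_C X hadj S0 (limit_end c) u \/ In u S0) /\ in_C X hadj S0 (limit_end c) w)
    | End _ E' => is_end X hadj E' /\ exists q, E' q /\
        exists k, forall n, (k <= n)%nat -> in_C X hadj S0 (limit_end c) (q n)
    end).
  split; [exists S0; intros [|]; reflexivity|].
  intros t' q' T2 L' Q.
  enough (a <= t' <= b) by (left; apply Rabs_def1; lra).
  destruct L' as [m x H|m x a2 y b2 G T3|c' C'].
  - destruct Q as [(w & Hw & I)|(u & w & E & _)]; [|destruct (vertex_point_not_edge _ _ _ E)].
    apply vertex_point_inv in Hw; subst w.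
    pose proof (vpos_blk _ _ _ _ _ _ _ B' Nr H (Inv _ I)). lra.
  - destruct (gap_props _ _ _ _ _ G) as [A _]. pose proof (fraction _ _ _ T3) as F.
    destruct (gap_vpos _ _ _ _ _ G) as [Hx Hy].
    destruct Q as [(w & Hw & _)|(u & w & E & _ & I)]; [destruct (edge_point_not_vertex _ _ _ _ A F Hw)|].
    pose proof (gap_no_vertex _ _ _ _ _ _ _ _ G Ha). pose proof (gap_no_vertex _ _ _ _ _ _ _ _ G Hb).
    apply Inv in I.
    destruct (edge_point_inv X hadj hadj_irrefl _ _ _ _ _ (hadj_irrefl _ _ A) F E) as [[-> ->]|[-> ->]].
    + pose proof (vpos_blk _ _ _ _ _ _ _ B' Nr Hy I). lra.
    + pose proof (vpos_blk _ _ _ _ _ _ _ B' Nr Hx I). lra.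
  (* A ray of the second end enters the component cut off by [S0], hence so does the base ray of c'.
     Its far vertices lie above v, so both chains use the same block on level n + 1. *)
  - destruct Q as (IE' & q & Eq & k & Hk).
    destruct (in_C_eventually X hadj hadj_sym S0 _ _ IE' Eq) as [k' Hk'].
    specialize (Hk (max k k') ltac:(lia)). specialize (Hk' (max k k') ltac:(lia)).
    apply (in_C_tail X hadj hadj_sym S0 _ (base c')) in Hk'; auto; [|eapply limit_end_base; eauto].
    destruct Hk' as [j Hj]. specialize (Hj (max j (S n)) ltac:(lia)).
    apply Inv in Hk. apply (Sep _ _ Hj) in Hk. simpl in Hk.
    destruct (C' (S n)) as (a2 & b2 & B2 & T3).
    destruct (blk_same _ _ _ _ _ _ _ _ B' B2 Hk) as (_ & <- & <-).
    { eapply chain_sub; eauto; lia. }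
    lra.
Qed.

Lemma located_inverse t q d : 0 < d -> located t q ->
  exists N, basic_nbhd q N /\
    forall t' q', -1 <= t' <= 3 -> located t' q' -> N q' -> near d t t'.
Proof.
  intros D [n x H|n x a y b G T|c C].
  - eapply located_inverse_vertex; eauto.
  - eapply located_inverse_edge; eauto.
  - eapply located_inverse_end; eauto.
Qed.

Lemma located_carrier t q : located t q -> carrier X hadj q.
Proof.
  intros [n x H|n x a y b G T|c C].
  - left. exists x. apply vertex_point_vertex.
  - right. exists x, y. apply (edge_point_edge X hadj hadj_irrefl); [apply (gap_props _ _ _ _ _ G)|].
    apply fraction; auto.
  - eapply limit_end_is_end; eauto.
Qed.

Lemma located_all_vertices x : exists t, -1 <= t < 3 /\
  forall q, located t q -> q = Pt X (vertex_point X x).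
Proof.
  destruct (vpos_exists x) as (n & t & H). pose proof (vpos_bounds _ _ _ H) as T.
  destruct (Req_dec t 3) as [->|N].
  (* The value 3 is not taken by [angle]; the vertex there is [(r, false)], which is also found at
     -1. *)
  - exists (-1). split; [lra|]. intros q L.
    assert (H3 : vpos n (r, false) 3) by (apply in_or_app; right; left; auto).
    rewrite (vpos_fun _ _ _ _ _ H H3). 
    apply (located_at_vertex 1 _ (-1)); auto. apply in_or_app; left; apply level_start.
  - exists t. split; [lra|]. intros q; eapply located_at_vertex; eauto.
Qed.
End Expansion.

(** * The circle *)

(* Walks along the upper half circle from (-1, 0) to (1, 0), then back along the lower one. *)
Definition angle (p : S1) : R :=
  if Rle_dec 0 (snd (proj1_sig p)) then fst (proj1_sig p) else 2 - fst (proj1_sig p).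

Lemma angle_bounds p : -1 <= angle p < 3.
Proof.
  destruct p as [[x y] H]; unfold angle; simpl in *. destruct (Rle_dec 0 y); nra.
Qed.

Lemma angle_surjective t : -1 <= t < 3 -> exists p, angle p = t.
Proof.
  intros T. destruct (Rle_dec t 1) as [L|L].
  - assert (E : fst (t, sqrt (1 - t ^ 2)) ^ 2 + snd (t, sqrt (1 - t ^ 2)) ^ 2 = 1).
    { unfold fst, snd. rewrite pow2_sqrt; [ring|nra]. }
    exists (exist (fun p : R * R => fst p ^ 2 + snd p ^ 2 = 1) _ E). unfold angle; simpl. destruct (Rle_dec 0 _) as [|N]; auto.
    destruct N; apply sqrt_pos.
  - assert (P : 0 < 1 - (2 - t) ^ 2) by nra.
    assert (E : fst (2 - t, - sqrt (1 - (2 - t) ^ 2)) ^ 2 +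
                snd (2 - t, - sqrt (1 - (2 - t) ^ 2)) ^ 2 = 1).
    { unfold fst, snd. replace ((- sqrt (1 - (2 - t) ^ 2)) ^ 2)
        with (sqrt (1 - (2 - t) ^ 2) ^ 2) by ring.
      rewrite pow2_sqrt; [ring|lra]. }
    exists (exist (fun p : R * R => fst p ^ 2 + snd p ^ 2 = 1) _ E). unfold angle, proj1_sig, fst, snd.
    pose proof (sqrt_lt_R0 _ P). destruct (Rle_dec 0 _); lra.
Qed.

Lemma S1_dist_sq p q : S1_dist p q ^ 2 =
  (fst (proj1_sig p) - fst (proj1_sig q)) ^ 2 + (snd (proj1_sig p) - snd (proj1_sig q)) ^ 2.
Proof. unfold S1_dist. apply pow2_sqrt, Rplus_le_le_0_compat; apply pow2_ge_0. Qed.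

Lemma S1_dist_pos p q : 0 <= S1_dist p q.
Proof. apply sqrt_pos. Qed.

Lemma S1_dist_sym p q : S1_dist p q = S1_dist q p.
Proof. unfold S1_dist; f_equal; ring. Qed.

Lemma near_sym d s t : near d s t -> near d t s.
Proof. unfold near. rewrite (Rabs_minus_sym s t); auto. Qed.

Lemma near_of_dist d : 0 < d -> exists e, 0 < e /\
  forall p q, S1_dist p q < e -> near d (angle p) (angle q).
Proof.
  intros D. set (e := Rmin (1 / 2) (d / 2)).
  assert (E1 : e <= 1 / 2) by apply Rmin_l. assert (E2 : e <= d / 2) by apply Rmin_r.
  assert (E : 0 < e) by (apply Rmin_glb_lt; lra). clearbody e.
  exists e; split; auto.
  (* Across the horizontal axis y^2 + y'^2 is at most the squared distance, so both points are close
     to the same one of (1, 0) and (-1, 0). The two formulas of [angle] agree at the former and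
     differ by 4 at the latter. *)
  assert (Opp : forall p q, 0 <= snd (proj1_sig p) -> snd (proj1_sig q) < 0 -> S1_dist p q < e ->
            near d (fst (proj1_sig p)) (2 - fst (proj1_sig q))).
  { intros p q Hp Hq L. pose proof (S1_dist_sq p q) as Sq. pose proof (S1_dist_pos p q) as Sp.
    destruct p as [[x y] P], q as [[x' y'] Q]; simpl in *.
    set (s := S1_dist _ _) in *. clearbody s.
    assert (S2 : s * s < e * e) by nra.
    pose proof (Rle_0_sqr (x - x')) as Sx. unfold Rsqr in Sx.
    assert (Syy : y * y' <= 0) by (clear - Hp Hq; nra).
    pose proof (Rle_0_sqr y) as Sy. pose proof (Rle_0_sqr y') as Sy'. unfold Rsqr in Sy, Sy'.
    assert (Y : y * y < e * e) by lra. assert (Y' : y' * y' < e * e) by lra.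
    assert (e * e <= e / 2) by nra.
    destruct (Rlt_le_dec 0 x) as [Px|Px], (Rlt_le_dec 0 x') as [Px'|Px'].
    - assert (1 - e / 2 < x) by nra. assert (1 - e / 2 < x') by nra.
      left. apply Rabs_def1; nra.
    - exfalso. assert (1 - e / 2 < x) by nra. assert (x' < - (1 - e / 2)) by nra. nra.
    - exfalso. assert (1 - e / 2 < x') by nra. assert (x < - (1 - e / 2)) by nra. nra.
    - assert (x < - (1 - e / 2)) by nra. assert (x' < - (1 - e / 2)) by nra.
      right. rewrite Rabs_left; lra. }
  assert (Same : forall p q, S1_dist p q < e ->
            Rabs (fst (proj1_sig p) - fst (proj1_sig q)) < d).
  { intros p q L. pose proof (S1_dist_sq p q) as Sq. pose proof (S1_dist_pos p q) as Sp.
    pose proof (pow2_ge_0 (snd (proj1_sig p) - snd (proj1_sig q))) as Sy.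
    set (s := S1_dist p q) in *. set (a := fst (proj1_sig p) - fst (proj1_sig q)) in *.
    clearbody s a. apply Rabs_def1; nra. }
  intros p q L. pose proof (Same p q L) as Sm. unfold angle.
  destruct (Rle_dec 0 (snd (proj1_sig p))), (Rle_dec 0 (snd (proj1_sig q))).
  - left; auto.
  - apply Opp; auto; lra.
  - apply near_sym, Opp; auto; [lra|]. rewrite S1_dist_sym; auto.
  - left. rewrite Rabs_minus_sym.
    replace (2 - fst (proj1_sig q) - (2 - fst (proj1_sig p)))
      with (fst (proj1_sig p) - fst (proj1_sig q)) by ring. auto.
Qed.

Lemma dist_of_near e : 0 < e -> exists d, 0 < d /\
  forall p q, near d (angle p) (angle q) -> S1_dist p q < e.
Proof.
  (* The squared distance is bounded by 4 d if different formulas of [angle] apply, and by 3 d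
     otherwise. *)
  intros E. assert (E2 : 0 < e * e) by nra. set (d := Rmin 1 (e * e / 8)).
  assert (D1 : d <= 1) by apply Rmin_l. assert (D2 : d <= e * e / 8) by apply Rmin_r.
  assert (D : 0 < d) by (apply Rmin_glb_lt; lra). clearbody d.
  exists d; split; auto.
  assert (Red : forall p q, S1_dist p q ^ 2 < e * e -> S1_dist p q < e).
  { intros p q H. pose proof (S1_dist_pos p q). nra. }
  (* For unit vectors |p - q|^2 + |p + q|^2 = 4, so with u = x + x' the squared distance is at most
     4 - u^2, hence at most 4 (2 - u) and at most 4 (2 + u). *)
  assert (Opp : forall p q, near d (fst (proj1_sig p)) (2 - fst (proj1_sig q)) -> S1_dist p q < e).
  { intros p q H. apply Red. rewrite S1_dist_sq.
    destruct p as [[x y] P], q as [[x' y'] Q]; simpl in *. destruct H as [H|H].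
    - apply Rabs_def2 in H.
      pose proof (Rle_0_sqr (x + x' - 2)) as Z1. pose proof (Rle_0_sqr (y + y')) as Z2.
      unfold Rsqr in *. lra.
    - assert (x <= 1) by (clear - P; nra). assert (x' <= 1) by (clear - Q; nra).
      rewrite Rabs_left1 in H by lra.
      pose proof (Rle_0_sqr (x + x' + 2)) as Z1. pose proof (Rle_0_sqr (y + y')) as Z2.
      unfold Rsqr in *. lra. }
  assert (Same : forall p q, 0 <= snd (proj1_sig p) * snd (proj1_sig q) ->
     near d (fst (proj1_sig p)) (fst (proj1_sig q)) -> S1_dist p q < e).
  { intros p q Y H. apply Red. rewrite S1_dist_sq.
    destruct p as [[x y] P], q as [[x' y'] Q]; simpl in *.
    assert (-1 <= x <= 1) by (clear - P; nra). assert (-1 <= x' <= 1) by (clear - Q; nra).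
    assert (H' : Rabs (x - x') < d).
    { destruct H as [H|H]; auto. unfold Rabs in *; destruct (Rcase_abs _); lra. }
    apply Rabs_def2 in H'.
    assert ((x - x') * (x - x') <= d) by nra.
    (* for coordinates of equal sign, (y - y')^2 <= |y^2 - y'^2| = |x^2 - x'^2| *)
    assert ((y - y') * (y - y') <= Rabs (y * y - y' * y')).
    { destruct (Rle_dec (y' * y') (y * y)).
      - rewrite Rabs_right by lra. nra.
      - rewrite Rabs_left by lra. nra. }
    replace (y * y - y' * y') with ((x' - x) * (x' + x)) in * by lra.
    assert (Rabs ((x' - x) * (x' + x)) <= 2 * d).
    { rewrite Rabs_mult. assert (Rabs (x' - x) <= d) by (apply Rabs_le; lra).
      assert (Rabs (x' + x) <= 2) by (apply Rabs_le; lra).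
      pose proof (Rabs_pos (x' - x)). pose proof (Rabs_pos (x' + x)). nra. }
    lra. }
  intros p q H. unfold angle in H.
  destruct (Rle_dec 0 (snd (proj1_sig p))), (Rle_dec 0 (snd (proj1_sig q))).
  - apply Same; auto. nra.
  - apply Opp; auto.
  - rewrite S1_dist_sym. apply Opp, near_sym; auto.
  - apply Same; [apply Rnot_le_lt in n, n0; nra|]. unfold near in *.
    replace (fst (proj1_sig p) - fst (proj1_sig q))
      with (- (2 - fst (proj1_sig p) - (2 - fst (proj1_sig q)))) by ring.
    rewrite Rabs_Ropp; auto.
Qed.

Lemma S1_dist_separates p q : (forall e, 0 < e -> S1_dist p q < e) -> p = q.
Proof.
  intros H. assert (Z : S1_dist p q = 0).
  { destruct (Rle_lt_or_eq_dec _ _ (S1_dist_pos p q)) as [L|]; auto. apply H in L; lra. }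
  pose proof (S1_dist_sq p q) as Sq. rewrite Z in Sq.
  destruct p as [[x y] P], q as [[x' y'] Q]; simpl in *.
  pose proof (Rle_0_sqr (x - x')) as Sx. pose proof (Rle_0_sqr (y - y')) as Sy.
  assert (x - x' = 0) by (apply Rsqr_0_uniq; unfold Rsqr in *; lra).
  assert (y - y' = 0) by (apply Rsqr_0_uniq; unfold Rsqr in *; lra).
  assert (x = x') by lra. assert (y = y') by lra. subst.
  f_equal. apply proof_irrelevance.
Qed.

(** * From the two estimates to an embedding *)

Section Circle.
Variables (X : Type) (adj : graph X).
Hypothesis adj_sym : forall u v, adj u v -> adj v u.
Variable curve : R -> point X -> Prop.
Hypothesis curve_exists : forall t, -1 <= t <= 3 -> exists q, curve t q.
Hypothesis curve_carrier : forall t q, curve t q -> carrier X adj q.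
Hypothesis curve_continuous : forall t q N, curve t q -> basic_nbhd X adj q N ->
  exists d, 0 < d /\ forall t' q', -1 <= t' <= 3 -> near d t t' -> curve t' q' -> N q'.
Hypothesis curve_inverse : forall t q d, 0 < d -> curve t q ->
  exists N, basic_nbhd X adj q N /\
    forall t' q', -1 <= t' <= 3 -> curve t' q' -> N q' -> near d t t'.

Lemma curve_embedding (f : S1 -> point X) :
  (forall p, curve (angle p) (f p)) -> embedding_S1 adj f.
Proof.
  intros Hf. assert (B : forall p, -1 <= angle p <= 3) by (intros p; pose proof (angle_bounds p); lra).
  split; [|split; [|split]].
  - intros p; eapply curve_carrier; eauto.
  (* The common image lies in every neighbourhood provided by [curve_inverse], so p and q are
     arbitrarily close. *)
  - intros p q E. apply S1_dist_separates. intros e He.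
    destruct (dist_of_near e He) as (d & D & H). apply H.
    destruct (curve_inverse _ _ d D (Hf p)) as (N & HN & I).
    apply (I _ (f q)); auto. rewrite <- E.
    eapply basic_nbhd_center; eauto.
  - intros O HO p Op. destruct (HO _ Op) as (_ & N & HN & I).
    destruct (curve_continuous _ _ _ (Hf p) HN) as (d & D & C).
    destruct (near_of_dist d D) as (e & He & H). exists e; split; auto.
    intros q L. apply I. apply (C (angle q)); auto.
  - intros U HU.
    (* The union of all basic neighbourhoods, around images of points of U, whose preimage stays
       inside U. *)
    exists (fun y => exists p N, U p /\ basic_nbhd X adj (f p) N /\ (forall q, N (f q) -> U q) /\ N y).
    split.
    + intros y (p & N & Up & HN & I & Ny).
      destruct (basic_nbhd_open X adj adj_sym _ _ _ (curve_carrier _ _ (Hf p)) HN Ny)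
        as (Cy & N' & HN' & I').
      split; auto. exists N'; split; auto. intros z Nz. exists p, N; auto.
    + intros p; split.
      * intros Up. destruct (HU _ Up) as (e & He & HUe).
        destruct (dist_of_near e He) as (d & D & H).
        destruct (curve_inverse _ _ d D (Hf p)) as (N & HN & I).
        exists p, N. split; auto. split; auto. split.
        -- intros q Nq. apply HUe, H. apply (I _ (f q)); auto.
        -- eapply basic_nbhd_center; eauto.
      * intros (q & N & _ & _ & I & Np); auto.
Qed.
End Circle.

Theorem theorem11 (V : Type) (adj : graph V) :
  simple_graph adj -> infinite_type V -> locally_finite adj -> connected adj ->
  hamiltonian_circle (box_K2 (graph_square adj)).
Proof.
  intros [Sy _] Inf LF Co.
  assert (Ne : forall l : list V, exists v, ~ In v l).
  { intros l. apply NNPP; intros N. apply Inf. exists l. intros v. apply NNPP; eauto. }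
  destruct (Ne []) as [o _].
  destruct (normal_spanning_tree V adj Sy LF Co o) as (r & up & U0 & U1 & U2).
  destruct (Ne [r]) as [v0 Hv0]. assert (Nr : v0 <> r) by (intros ->; apply Hv0; left; auto).
  set (curve := located V adj Sy LF r up U0 U1).
  destruct (pointwise_choice (fun p q => curve (angle p) q)) as [f Hf].
  { intros p. apply located_exists. pose proof (angle_bounds p); lra. }
  exists (fun x => exists p, f p = x). split.
  - exists f. split; [|intros x; reflexivity].
    apply (curve_embedding _ _ (hadj_sym V adj Sy) curve); auto.
    + intros t q; apply located_carrier.
    + intros t q N; apply located_continuous; auto.
    + intros t q d; apply located_inverse with v0; auto.
  - intros v. exists (vertex_point _ v). split; [apply vertex_point_vertex|].
    destruct (located_all_vertices V adj Sy LF r up U0 U1 v) as (t & T & H).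
    destruct (angle_surjective t T) as [p <-]. exists p. apply H, Hf.
Qed.
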